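(* Let $\mathfrak{X}$ be an abstract state space, $(\mathcal{U}(t))_{t\ge0}$ a substochastic $C_0$-semigroup on $\mathfrak{X}$ with generator $\mathcal{A}$, $\mathcal{B}:\mathscr{D}(\mathcal{A})\to\mathfrak{X}$ a positive linear operator with $\langle\mathbf{\Psi},(\mathcal{A}+\mathcal{B})u\rangle\le0$ for all $u\in\mathscr{D}(\mathcal{A})\cap\mathfrak{X}_+$, and let $(\mathcal{V}(t))_{t\ge0}$ be the associated minimal substochastic $C_0$-semigroup. Then for every $t\ge0$ the Duhamel formula $$\mathcal{V}(t)u=\mathcal{U}(t)u+\int_0^t\mathcal{V}(t-s)\mathcal{B}\,\mathcal{U}(s)u\,\mathrm{d}s,\qquad u\in\mathscr{D}(\mathcal{A}),$$ holds. Moreover, $(\mathcal{V}(t))_{t\ge0}$ is given by the Dyson–Phillips expansion $$\mathcal{V}(t)=\sum_{n=0}^\infty\mathscr{L}^n(\mathcal{U})(t),\qquad t\ge0,$$ where the series converges strongly in $\mathfrak{X}$.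
   Context: An abstract state space is a real ordered Banach space $\mathfrak{X}$ whose positive cone $\mathfrak{X}_+$ is closed, generating ($\mathfrak{X}=\mathfrak{X}_+-\mathfrak{X}_+$), and on which the norm is additive: $\|u+v\|=\|u\|+\|v\|$ for $u,v\in\mathfrak{X}_+$. $\mathbf{\Psi}\in\mathfrak{X}^\star_+$ is the positive functional with $\langle\mathbf{\Psi},u\rangle=\|u\|$ for $u\in\mathfrak{X}_+$. A linear operator is positive if it maps positive elements of its domain into $\mathfrak{X}_+$. A $C_0$-semigroup $(T(t))_{t\ge0}$ is substochastic if each $T(t)$ is positive and $\|T(t)u\|\le\|u\|$ for $u\in\mathfrak{X}_+$. Minimal semigroup: under the stated hypotheses there is a smallest (for the operator order, for each $t$) substochastic $C_0$-semigroup $(\mathcal{V}(t))_{t\ge0}$ whose generator $\mathcal{G}$ extends $(\mathcal{A}+\mathcal{B},\mathscr{D}(\mathcal{A}))$; it satisfies $(\lambda-\mathcal{G})^{-1}u=\lim_{n\to\infty}(\lambda-\mathcal{A})^{-1}\sum_{k=0}^n[\mathcal{B}(\lambda-\mathcal{A})^{-1}]^ku$ for all $\lambda>0$, $u\in\mathfrak{X}$. Operator $\mathscr{L}$: for a strongly continuous, bounded map $\mathcal{S}:[0,\infty)\to\mathscr{B}(\mathfrak{X})$ with each $\mathcal{S}(t)$ positive, $\mathscr{L}(\mathcal{S})(t)$ is the unique bounded (positive) extension to $\mathfrak{X}$ of the operator $u\in\mathscr{D}(\mathcal{A})\mapsto\int_0^t\mathcal{S}(t-s)\mathcal{B}\,\mathcal{U}(s)u\,\mathrm{d}s$;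 the map $t\mapsto\mathscr{L}(\mathcal{S})(t)$ is again strongly continuous and bounded, so the iterates $\mathscr{L}^n$ are defined, with $\mathscr{L}^0(\mathcal{U})=\mathcal{U}$. *)

(* Defs.v *)
From Stdlib Require Import Reals ClassicalEpsilon.
From Coquelicot Require Import Coquelicot.
Open Scope R_scope.

Record is_abstract_state_space (X : CompleteNormedModule R_AbsRing)
    (pos : X -> Prop) : Prop := {
  pos_zero : pos zero;
  pos_plus : forall u v : X, pos u -> pos v -> pos (plus u v);
  pos_scal : forall (c : R) (u : X), 0 <= c -> pos u -> pos (scal c u);
  pos_proper : forall u : X, pos u -> pos (opp u) -> u = zero;
  pos_closed : closed pos;
  pos_generating :
    forall w : X, exists u v : X, pos u /\ pos v /\ w = minus u v;
  pos_norm_additive :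
    forall u v : X, pos u -> pos v -> norm (plus u v) = norm u + norm v
}.

(* At most one functional satisfies this, because the cone is generating;
   its positivity is contained in the second condition. *)
Definition is_norm_functional (X : CompleteNormedModule R_AbsRing)
    (pos : X -> Prop) (Psi : X -> R) : Prop :=
  is_linear (V := R_NormedModule) Psi /\ forall u : X, pos u -> Psi u = norm u.

(* Families indexed by [0, +oo) are maps on R; their values at negative times
   are irrelevant. Coquelicot's [is_linear] means linear and bounded. *)
Record is_C0_semigroup (X : CompleteNormedModule R_AbsRing)
    (T : R -> X -> X) : Prop := {
  sg_linear : forall t : R, 0 <= t -> is_linear (T t);
  sg_zero : forall u : X, T 0 u = u;
  sg_plus : forall (s t : R) (u : X),
    0 <= s -> 0 <= t -> T (s + t) u = T s (T t u);
  sg_continuous : forall u : X,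
    filterlim (fun t : R => T t u) (at_right 0) (locally u)
}.

Record is_substochastic_C0_semigroup (X : CompleteNormedModule R_AbsRing)
    (pos : X -> Prop) (T : R -> X -> X) : Prop := {
  sub_semigroup : is_C0_semigroup X T;
  sub_positive : forall (t : R) (u : X), 0 <= t -> pos u -> pos (T t u);
  sub_contractive : forall (t : R) (u : X),
    0 <= t -> pos u -> norm (T t u) <= norm u
}.

(* [(u, v)] belongs to the graph of the generator of [T]. *)
Definition generator_graph (X : CompleteNormedModule R_AbsRing)
    (T : R -> X -> X) (u v : X) : Prop :=
  filterlim (fun h : R => scal (/ h) (minus (T h u) u))
    (at_right 0) (locally v).

(* An unbounded operator is a domain [D] together with a total map, of which
   only the values on [D] matter. *)
Definition is_generator (X : CompleteNormedModule R_AbsRing)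
    (T : R -> X -> X) (D : X -> Prop) (A : X -> X) : Prop :=
  (forall u : X, D u <-> exists v : X, generator_graph X T u v) /\
  (forall u : X, D u -> generator_graph X T u (A u)).

Definition generator_extends (X : CompleteNormedModule R_AbsRing)
    (T : R -> X -> X) (D : X -> Prop) (C : X -> X) : Prop :=
  forall u : X, D u -> generator_graph X T u (C u).

Record is_positive_linear_on (X : CompleteNormedModule R_AbsRing)
    (pos D : X -> Prop) (B : X -> X) : Prop := {
  on_plus : forall u v : X, D u -> D v -> B (plus u v) = plus (B u) (B v);
  on_scal : forall (c : R) (u : X), D u -> B (scal c u) = scal c (B u);
  on_positive : forall u : X, D u -> pos u -> pos (B u)
}.

(* The smallest substochastic C0-semigroup whose generator extends [(C, D)]. *)
Record is_minimal_semigroup (X : CompleteNormedModule R_AbsRing)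
    (pos D : X -> Prop) (C : X -> X) (V : R -> X -> X) : Prop := {
  min_substochastic : is_substochastic_C0_semigroup X pos V;
  min_extends : generator_extends X V D C;
  min_least : forall W : R -> X -> X,
    is_substochastic_C0_semigroup X pos W -> generator_extends X W D C ->
    forall (t : R) (u : X), 0 <= t -> pos u -> pos (minus (W t u) (V t u))
}.

(* The integrands below are continuous in [s], so the Riemann integral of
   Coquelicot in a Banach space is the integral meant. *)
Definition is_Duhamel_extension (X : CompleteNormedModule R_AbsRing)
    (D : X -> Prop) (B : X -> X) (U S : R -> X -> X) (t : R)
    (E : X -> X) : Prop :=
  is_linear E /\
  forall u : X, D u ->
    is_RInt (fun s : R => S (t - s) (B (U s u))) 0 t (E u).

(* [E] is unique since [D] is dense; it exists for [S] positive, bounded and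
   strongly continuous, and is then positive. *)
Definition DP_operator (X : CompleteNormedModule R_AbsRing)
    (D : X -> Prop) (B : X -> X) (U S : R -> X -> X) : R -> X -> X :=
  fun t : R =>
    epsilon (inhabits (fun u : X => u)) (is_Duhamel_extension X D B U S t).

Definition DP_term (X : CompleteNormedModule R_AbsRing)
    (D : X -> Prop) (B : X -> X) (U : R -> X -> X) (n : nat) : R -> X -> X :=
  Nat.iter n (DP_operator X D B U) U.

(* Main.v *)
(* Since V(t-s) U(s) u has right derivative - V(t-s) B U(s) u for u in D, integration
   gives the Duhamel formula for V. Iterating it on the cone bounds the partial sums
   of the Dyson-Phillips series by V, so every L^n(U) exists, and the series converges
   because the norm is additive on the cone. The identity
   L^n(U)(t+s) = sum_{j<=n} L^j(U)(t) L^{n-j}(U)(s) makes its sum W a semigroup. On the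
   cone U + L(U) <= W <= V; as U + L(U) and V have the same right derivative at 0 on
   the positive part of D, the generator of W extends A + B, whence V <= W by
   minimality.

   No resolvent is needed: integration by parts yields
   u = int_0^1 U(s) u ds - int_0^1 (1-s) U(s) A u ds on D, and the dissipativity
   assumption bounds B on the range of each of the two integrals. *)
Require Import Defs.
From Stdlib Require Import Reals Lra Lia List ClassicalEpsilon Classical.
From Coquelicot Require Import Coquelicot.
Open Scope R_scope.

(** * Linear combinations *)

(** Contractivity is assumed on the cone only, and a generating cone gives u = v - w without any
    control of v and w. Baire's theorem supplies a constant [M] with norm v + norm w <= M * norm u,
    and this [M] enters every estimate on the whole space. A second obstacle is that inequalities
    are obtained on positive elements of [D], so approximants taken from [D] must remain positive.
    Means of orbits over [0, h] have this property. A third one is that the terms are selected by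
    [epsilon]: nothing is known of L^{n+1}(U) before some extension has been produced, and its
    strong continuity, required for integrating it once more, cannot be read off the extension. It
    comes from the identity for L^{n+1}(U)(t+s): on the cone L^{n+1}(U)(h) u lies below V(h) u -
    U(h) u, which tends to 0 with h. Existence, domination, the identity and continuity are
    therefore carried through one common induction. *)

Inductive vexpr :=
  | VAtom (n : nat) | VZero | VPlus (a b : vexpr) | VMinus (a b : vexpr)
  | VOpp (a : vexpr) | VScal (c : R) (a : vexpr).

Fixpoint veval {V : ModuleSpace R_Ring} (l : list V) (e : vexpr) : V :=
  match e with
  | VAtom n => nth n l zero
  | VZero => zero
  | VPlus a b => plus (veval l a) (veval l b)
  | VMinus a b => minus (veval l a) (veval l b)
  | VOpp a => opp (veval l a)
  | VScal c a => scal c (veval l a)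
  end.

(** The normal form used for reflection: an expression is determined by the coefficients of its
    atoms, which turns an equation between vectors into finitely many equations between reals. *)
Fixpoint vcoef (e : vexpr) (i : nat) : R :=
  match e with
  | VAtom n => if Nat.eqb n i then 1 else 0
  | VZero => 0
  | VPlus a b => vcoef a i + vcoef b i
  | VMinus a b => vcoef a i - vcoef b i
  | VOpp a => - vcoef a i
  | VScal c a => c * vcoef a i
  end.

Fixpoint vcomb {V : ModuleSpace R_Ring} (l : list V) (c : nat -> R) : V :=
  match l with
  | nil => zero
  | x :: l' => plus (scal (c 0%nat) x) (vcomb l' (fun i => c (S i)))
  end.

Lemma vcomb_plus {V : ModuleSpace R_Ring} (l : list V) (c d : nat -> R) :
  vcomb l (fun i => c i + d i) = plus (vcomb l c) (vcomb l d).
Proof.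
  revert c d; induction l as [|x l IH]; intros c d; simpl.
  - now rewrite plus_zero_l.
  - rewrite (IH (fun i => c (S i)) (fun i => d (S i))).
    rewrite (scal_distr_r (c 0%nat) (d 0%nat) x
      : scal (c 0%nat + d 0%nat) x = _), <- !plus_assoc. f_equal.
    rewrite !plus_assoc. f_equal. apply plus_comm.
Qed.

Lemma vcomb_scal {V : ModuleSpace R_Ring} (l : list V) (k : R) (c : nat -> R) :
  vcomb l (fun i => k * c i) = scal k (vcomb l c).
Proof.
  revert c; induction l as [|x l IH]; intros c; simpl.
  - now rewrite scal_zero_r.
  - rewrite (IH (fun i => c (S i))), scal_distr_l. f_equal.
    symmetry; exact (scal_assoc k (c 0%nat) x).
Qed.

Lemma vcomb_ext {V : ModuleSpace R_Ring} (l : list V) (c d : nat -> R) :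
  (forall i, c i = d i) -> vcomb l c = vcomb l d.
Proof.
  revert c d; induction l as [|x l IH]; intros c d H; simpl; trivial.
  rewrite H. f_equal. apply IH. intros; apply H.
Qed.

Lemma vcomb_zero {V : ModuleSpace R_Ring} (l : list V) :
  vcomb l (fun _ => 0) = zero.
Proof.
  induction l as [|x l IH]; simpl; trivial.
  rewrite IH, plus_zero_r. exact (scal_zero_l x).
Qed.

Lemma vcomb_atom {V : ModuleSpace R_Ring} (l : list V) (n : nat) :
  vcomb l (fun i => if Nat.eqb n i then 1 else 0) = nth n l zero.
Proof.
  revert n; induction l as [|x l IH]; intros [|n]; simpl; trivial.
  - rewrite vcomb_zero, plus_zero_r. exact (scal_one x).
  - rewrite IH, (scal_zero_l x : scal 0 x = zero). apply plus_zero_l.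
Qed.

Lemma vcomb_opp {V : ModuleSpace R_Ring} (l : list V) (c : nat -> R) :
  vcomb l (fun i => - c i) = opp (vcomb l c).
Proof.
  rewrite <- (scal_opp_one (K := R_Ring)).
  rewrite <- (vcomb_scal l (-1) c : _ = scal (opp one) _).
  apply vcomb_ext; intros; ring.
Qed.

Lemma veval_vcomb {V : ModuleSpace R_Ring} (l : list V) (e : vexpr) :
  veval l e = vcomb l (vcoef e).
Proof.
  induction e as [n| |a IHa b IHb|a IHa b IHb|a IHa|c a IHa]; simpl.
  - now rewrite vcomb_atom.
  - now rewrite vcomb_zero.
  - now rewrite IHa, IHb, vcomb_plus.
  - rewrite IHa, IHb. unfold minus. rewrite <- vcomb_opp.
    exact (eq_sym (vcomb_plus l _ _)).
  - now rewrite IHa, vcomb_opp.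
  - now rewrite IHa, vcomb_scal.
Qed.

(** Written as an iterated conjunction, so that it computes to one real equation per atom; the shift
    of indices follows the recursion of [vcomb]. *)
Fixpoint vsame (n : nat) (c d : nat -> R) : Prop :=
  match n with
  | O => True
  | S n' => c 0%nat = d 0%nat /\ vsame n' (fun i => c (S i)) (fun i => d (S i))
  end.

Lemma veval_eq {V : ModuleSpace R_Ring} (l : list V) (e f : vexpr) :
  vsame (length l) (vcoef e) (vcoef f) -> veval l e = veval l f.
Proof.
  rewrite !veval_vcomb. generalize (vcoef e) (vcoef f).
  induction l as [|x l IH]; intros c d; simpl; trivial.
  intros [-> H]. f_equal. now apply IH.
Qed.

(** Typing [eq_refl] compares atoms up to conversion, so that terms differing by their path in the
    hierarchy of structures are one atom. *)
Ltac vec_lookup x l :=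
  lazymatch l with
  | nil => fail
  | ?y :: ?l' =>
    match constr:(Set) with
    | _ => let _ := constr:(eq_refl : x = y) in constr:(0%nat)
    | _ => let n := vec_lookup x l' in constr:(S n)
    end
  end.

Ltac vec_atoms t l :=
  lazymatch t with
  | plus ?a ?b => let l1 := vec_atoms a l in vec_atoms b l1
  | minus ?a ?b => let l1 := vec_atoms a l in vec_atoms b l1
  | opp ?a => vec_atoms a l
  | scal _ ?a => vec_atoms a l
  | zero => l
  | ?x =>
    match constr:(Set) with
    | _ => let n := vec_lookup x l in l
    | _ => constr:(x :: l)
    end
  end.

Ltac vec_reify t l :=
  lazymatch t with
  | plus ?a ?b =>
    let a' := vec_reify a l in let b' := vec_reify b l in constr:(VPlus a' b')
  | minus ?a ?b =>
    let a' := vec_reify a l in let b' := vec_reify b l in constr:(VMinus a' b')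
  | opp ?a => let a' := vec_reify a l in constr:(VOpp a')
  | scal ?c ?a => let a' := vec_reify a l in constr:(VScal c a')
  | zero => constr:(VZero)
  | ?x => let n := vec_lookup x l in constr:(VAtom n)
  end.

(* Decides equality of linear combinations by comparing the coefficients of
   each atom. *)
Ltac vec :=
  lazymatch goal with
  | |- @eq ?T ?a ?b =>
    let l0 := vec_atoms a (@nil T) in
    let l := vec_atoms b l0 in
    let a' := vec_reify a l in
    let b' := vec_reify b l in
    refine (veval_eq l a' b' _);
    cbn [length vsame vcoef Nat.eqb];
    repeat (split; [try ring; try (field; lra)|]); try exact I
  end.

(* Unlike the basic [rewrite], the one of ssreflect finds instances up to the
   different paths in the hierarchy of structures. *)
Require ssreflect.
Module VectorRewriting.
Import ssreflect.
Tactic Notation "vreplace" constr(a) "with" constr(b) :=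
  let E := fresh in
  assert (E : a = b); [vec|rewrite E; clear E].
End VectorRewriting.
Import VectorRewriting.

(** * Limits and bounded operators *)

Section Limits.
Context {V : CompleteNormedModule R_AbsRing}.

Lemma lim_norm_iff {T} {F : (T -> Prop) -> Prop} {FF : Filter F} (f : T -> V) l :
  filterlim f F (locally l) <->
  forall eps : R, 0 < eps -> F (fun x => norm (minus (f x) l) < eps).
Proof.
  split.
  - intros H eps He.
    exact (proj1 (filterlim_locally_ball_norm f l) H (mkposreal eps He)).
  - intros H. apply (proj2 (filterlim_locally_ball_norm f l)).
    intros eps. exact (H eps (cond_pos eps)).
Qed.

Lemma norm_scal_le (c : R) (u : V) : norm (scal c u) <= Rabs c * norm u.
Proof. exact (norm_scal c u). Qed.

(* The next lemmas restate library facts so that the algebraic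
   operations are projected directly from [CompleteNormedModule]. *)
Lemma cnorm_triangle (u v : V) : norm (plus u v) <= norm u + norm v.
Proof. exact (norm_triangle u v). Qed.

Lemma cnorm_zero : norm (@zero V) = 0.
Proof. exact (@norm_zero _ V). Qed.

Lemma cnorm_eq_zero (u : V) : norm u = 0 -> u = zero.
Proof. exact (@norm_eq_zero _ V u). Qed.

Lemma cnorm_opp (u : V) : norm (opp u) = norm u.
Proof. exact (norm_opp u). Qed.

Lemma norm_minus_sym (u v : V) : norm (minus u v) = norm (minus v u).
Proof. rewrite <- cnorm_opp. f_equal. vec. Qed.

Lemma norm_minus_trans (u v w : V) :
  norm (minus u w) <= norm (minus u v) + norm (minus v w).
Proof.
  vreplace (minus u w) with (plus (minus u v) (minus v w)).
  apply cnorm_triangle.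
Qed.

Lemma norm_minus_le (u v : V) : norm (minus u v) <= norm u + norm v.
Proof. rewrite <- (cnorm_opp v). apply (cnorm_triangle u (opp v)). Qed.

Lemma norm_le_minus (u v : V) : norm u <= norm v + norm (minus u v).
Proof.
  replace u with (plus v (minus u v)) at 1 by vec. apply cnorm_triangle.
Qed.

Lemma minus_zero_eq (u v : V) : minus u v = zero -> u = v.
Proof. intros H. vreplace u with (plus v (minus u v)). rewrite H. vec. Qed.

Lemma norm_small_eq (u v : V) :
  (forall eps, 0 < eps -> norm (minus u v) <= eps) -> u = v.
Proof.
  intros H. apply minus_zero_eq, cnorm_eq_zero.
  apply Rle_antisym; [|apply norm_ge_0].
  apply Rnot_lt_le; intros K. specialize (H (norm (minus u v) / 2)). lra.
Qed.

Context {T : Type} {F : (T -> Prop) -> Prop} {FF : Filter F}.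

Lemma lim_plus (f g : T -> V) a b :
  filterlim f F (locally a) -> filterlim g F (locally b) ->
  filterlim (fun x => plus (f x) (g x)) F (locally (plus a b)).
Proof. intros Hf Hg. exact (filterlim_comp_2 _ _ _ Hf Hg (filterlim_plus a b)). Qed.

Lemma lim_opp (f : T -> V) a :
  filterlim f F (locally a) ->
  filterlim (fun x => opp (f x)) F (locally (opp a)).
Proof. intros Hf. exact (filterlim_comp _ _ _ _ _ _ _ _ Hf (filterlim_opp a)). Qed.

Lemma lim_minus (f g : T -> V) a b :
  filterlim f F (locally a) -> filterlim g F (locally b) ->
  filterlim (fun x => minus (f x) (g x)) F (locally (minus a b)).
Proof. intros Hf Hg. apply lim_plus; trivial. now apply lim_opp. Qed.

Lemma lim_scal (c : R) (f : T -> V) a :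
  filterlim f F (locally a) ->
  filterlim (fun x => scal c (f x)) F (locally (scal c a)).
Proof.
  intros Hf.
  exact (filterlim_comp _ _ _ _ _ _ _ _ Hf (filterlim_scal_r (K := R_AbsRing) c a)).
Qed.

Lemma lim_zero_le (f : T -> V) l (g : T -> R) :
  F (fun x => norm (minus (f x) l) <= g x) ->
  filterlim g F (locally 0) -> filterlim f F (locally l).
Proof.
  intros H Hg. apply lim_norm_iff. intros eps He.
  assert (K : F (fun x => Rabs (g x - 0) < eps)).
  { apply (proj1 (filterlim_locally g 0) Hg (mkposreal eps He)). }
  generalize (filter_and _ _ H K). apply filter_imp. intros x [H1 H2].
  apply Rle_lt_trans with (2 := H2), Rle_trans with (1 := H1).
  rewrite Rminus_0_r. apply Rle_abs.
Qed.

Lemma lim_norm_zero (f : T -> V) l :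
  filterlim f F (locally l) ->
  filterlim (fun x => norm (minus (f x) l)) F (locally 0).
Proof.
  intros H. apply filterlim_locally. intros eps.
  generalize (proj1 (lim_norm_iff f l) H eps (cond_pos eps)).
  apply filter_imp. intros x Hx.
  change (Rabs (norm (minus (f x) l) - 0) < eps).
  rewrite Rminus_0_r, Rabs_pos_eq; trivial. apply norm_ge_0.
Qed.

Lemma limR_plus (f g : T -> R) a b :
  filterlim f F (locally a) -> filterlim g F (locally b) ->
  filterlim (fun x => f x + g x) F (locally (a + b)).
Proof.
  intros Hf Hg.
  exact (filterlim_comp_2 _ _ _ Hf Hg (filterlim_plus (V := R_NormedModule) a b)).
Qed.

Lemma limR_scal (c : R) (f : T -> R) a :
  filterlim f F (locally a) -> filterlim (fun x => c * f x) F (locally (c * a)).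
Proof.
  intros Hf. exact (filterlim_comp _ _ _ _ _ _ _ _ Hf
    (filterlim_scal_r (K := R_AbsRing) (V := R_NormedModule) c a)).
Qed.

Lemma limR_zero_scal (c : R) (f : T -> R) :
  filterlim f F (locally 0) -> filterlim (fun x => c * f x) F (locally 0).
Proof. intros H. rewrite <- (Rmult_0_r c) at 1. now apply limR_scal. Qed.

Lemma limR_zero_plus (f g : T -> R) :
  filterlim f F (locally 0) -> filterlim g F (locally 0) ->
  filterlim (fun x => f x + g x) F (locally 0).
Proof. intros Hf Hg. rewrite <- (Rplus_0_r 0). now apply limR_plus. Qed.

Lemma lim_unique {PF : ProperFilter' F} (f : T -> V) a b :
  filterlim f F (locally a) -> filterlim f F (locally b) -> a = b.
Proof. exact (filterlim_locally_unique (F := F) f a b). Qed.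

Lemma lim_norm_le {PF : ProperFilter' F} (f : T -> V) l c :
  filterlim f F (locally l) -> F (fun x => norm (f x) <= c) -> norm l <= c.
Proof.
  intros H Hc. apply Rnot_lt_le; intros K.
  apply (filter_not_empty (F := F)).
  generalize (filter_and _ _ Hc (proj1 (lim_norm_iff f l) H (norm l - c) ltac:(lra))).
  apply filter_imp. intros x [H1 H2].
  generalize (norm_le_minus l (f x)); rewrite norm_minus_sym. lra.
Qed.

(* Equicontinuous operators [L x] may be evaluated at a convergent argument. *)
Lemma lim_equicontinuous {W : CompleteNormedModule R_AbsRing} (L : T -> W -> V)
    (f : T -> W) w l M :
  F (fun x => forall u v, minus (L x u) (L x v) = L x (minus u v)) ->
  F (fun x => forall u, norm (L x u) <= M * norm u) ->
  filterlim f F (locally w) -> filterlim (fun x => L x w) F (locally l) ->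
  filterlim (fun x => L x (f x)) F (locally l).
Proof.
  intros HL HM Hf Hw.
  apply lim_zero_le with
    (g := fun x => M * norm (minus (f x) w) + norm (minus (L x w) l)).
  - generalize (filter_and _ _ HL HM). apply filter_imp. intros x [H1 H2].
    apply Rle_trans with (1 := norm_minus_trans _ (L x w) _).
    apply Rplus_le_compat_r. rewrite H1. apply H2.
  - apply limR_zero_plus.
    + apply limR_zero_scal. apply filterlim_locally. intros eps.
      generalize (proj1 (filterlim_locally_ball_norm f w) Hf eps).
      apply filter_imp. intros x Hx.
      change (Rabs (norm (minus (f x) w) - 0) < eps).
      rewrite Rminus_0_r, Rabs_pos_eq; [exact Hx|apply norm_ge_0].
    + now apply lim_norm_zero.
Qed.

End Limits.

(** * Bounded linear maps, finite sums and completeness *)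

Lemma clinear_minus {V W : CompleteNormedModule R_AbsRing} (L : V -> W) u v :
  is_linear L -> L (minus u v) = minus (L u) (L v).
Proof.
  intros H. vreplace (minus u v) with (plus u (scal (-1) v)).
  rewrite (linear_plus L H), (linear_scal L H). vec.
Qed.

Lemma clinear_zero {V W : CompleteNormedModule R_AbsRing} (L : V -> W) :
  is_linear L -> L zero = zero.
Proof.
  intros H. replace (@zero V) with (@scal _ V 0 zero) at 1 by vec.
  rewrite (linear_scal L H). vec.
Qed.

Lemma clinear_add {V W : CompleteNormedModule R_AbsRing} (L L' : V -> W) :
  is_linear L -> is_linear L' -> is_linear (fun u => plus (L u) (L' u)).
Proof.
  intros H H'. split.
  - intros u v. rewrite (linear_plus L H), (linear_plus L' H'). vec.
  - intros c u. rewrite (linear_scal L H), (linear_scal L' H'). vec.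
  - destruct (linear_norm L H) as [K [HK E]], (linear_norm L' H') as [K' [HK' E']].
    exists (K + K'). split; [lra|]. intros u.
    apply Rle_trans with (1 := cnorm_triangle _ _). generalize (E u) (E' u). lra.
Qed.

Lemma clinear_sub {V W : CompleteNormedModule R_AbsRing} (L L' : V -> W) :
  is_linear L -> is_linear L' -> is_linear (fun u => minus (L u) (L' u)).
Proof.
  intros H H'. split.
  - intros u v. rewrite (linear_plus L H), (linear_plus L' H'). vec.
  - intros c u. rewrite (linear_scal L H), (linear_scal L' H'). vec.
  - destruct (linear_norm L H) as [K [HK E]], (linear_norm L' H') as [K' [HK' E']].
    exists (K + K'). split; [lra|]. intros u.
    apply Rle_trans with (1 := norm_minus_le _ _). generalize (E u) (E' u). lra.
Qed.

Lemma clinear_sum_n {V W : CompleteNormedModule R_AbsRing} (L : nat -> V -> W) n :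
  (forall k, (k <= n)%nat -> is_linear (L k)) ->
  is_linear (fun u => sum_n (fun k => L k u) n).
Proof.
  induction n as [|n IH]; intros H.
  - apply is_linear_ext with (L 0%nat); [|now apply H].
    intros u. now rewrite sum_O.
  - apply is_linear_ext with (fun u => plus (sum_n (fun k => L k u) n) (L (S n) u)).
    + intros u. now rewrite sum_Sn.
    + apply clinear_add; [apply IH; intros; apply H; lia|now apply H].
Qed.

Lemma clinear_of_sum_n {V W : CompleteNormedModule R_AbsRing} (L : V -> W) a n :
  is_linear L -> L (sum_n a n) = sum_n (fun k => L (a k)) n.
Proof.
  intros H. induction n as [|n IH]; [now rewrite !sum_O|].
  rewrite !sum_Sn, <- IH. apply (linear_plus L H).
Qed.

Lemma sum_n_head {V : CompleteNormedModule R_AbsRing} (a : nat -> V) n :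
  sum_n a (S n) = plus (a 0%nat) (sum_n (fun k => a (S k)) n).
Proof.
  induction n as [|n IH]; [now rewrite sum_Sn, !sum_O|].
  rewrite sum_Sn, IH, (sum_Sn (fun k => a (S k))).
  symmetry. apply (plus_assoc (a 0%nat)).
Qed.

Lemma lim_sum_n {V : CompleteNormedModule R_AbsRing} {T} {F : (T -> Prop) -> Prop}
    {FF : Filter F} (f : nat -> T -> V) l n :
  (forall k, (k <= n)%nat -> filterlim (f k) F (locally (l k))) ->
  filterlim (fun x => sum_n (fun k => f k x) n) F (locally (sum_n l n)).
Proof.
  induction n as [|n IH]; intros H.
  - rewrite sum_O. apply filterlim_ext with (f 0%nat); [|now apply H].
    intros x. now rewrite sum_O.
  - rewrite sum_Sn.
    apply filterlim_ext with (fun x => plus (sum_n (fun k => f k x) n) (f (S n) x)).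
    + intros x. now rewrite sum_Sn.
    + apply lim_plus; [apply IH; intros; apply H; lia|now apply H].
Qed.

Lemma lim_linear {V W : CompleteNormedModule R_AbsRing} {T} {F : (T -> Prop) -> Prop}
    {FF : Filter F} (L : V -> W) (f : T -> V) l :
  is_linear L -> filterlim f F (locally l) ->
  filterlim (fun x => L (f x)) F (locally (L l)).
Proof.
  intros H Hf. destruct (linear_norm L H) as [M [HM K]].
  apply (lim_equicontinuous (fun _ => L) f l (L l) M); trivial.
  - apply filter_forall. intros _ u v. symmetry. now apply clinear_minus.
  - now apply filter_forall.
  - apply filterlim_const.
Qed.

Lemma cauchy_seq_lim {V : CompleteNormedModule R_AbsRing} (x : nat -> V) :
  (forall eps, 0 < eps -> exists N, forall m n, (N <= m)%nat -> (N <= n)%nat ->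
     norm (minus (x m) (x n)) < eps) ->
  exists l, filterlim x eventually (locally l).
Proof.
  intros H.
  refine (proj1 (filterlim_locally_cauchy (U := CompleteNormedModule.CompleteSpace _ V)
    (F := eventually) x) _). intros eps.
  destruct (H eps (cond_pos eps)) as [N HN].
  exists (fun n => (N <= n)%nat). split; [now exists N|].
  intros m n Hm Hn. apply (norm_compat1 (V := V)), HN; trivial.
Qed.

(** * The cone and the bounded decomposition *)

Section Cone.
Context {X : CompleteNormedModule R_AbsRing} {pos : X -> Prop}.
Hypothesis HX : is_abstract_state_space X pos.

Lemma pos_norm_mono (u v : X) : pos u -> pos (minus v u) -> norm u <= norm v.
Proof.
  intros Hu Hv. replace v with (plus u (minus v u)) at 1 by vec.
  rewrite (pos_norm_additive _ _ HX) by trivial.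
  generalize (norm_ge_0 (minus v u)); lra.
Qed.

Lemma pos_minus_trans (u v w : X) :
  pos (minus v u) -> pos (minus w v) -> pos (minus w u).
Proof.
  intros H1 H2. vreplace (minus w u) with (plus (minus v u) (minus w v)).
  now apply (pos_plus _ _ HX).
Qed.

Lemma pos_minus_refl (u : X) : pos (minus u u).
Proof. vreplace (minus u u) with (@zero X). apply (pos_zero _ _ HX). Qed.

Lemma pos_minus_antisym (u v : X) : pos (minus u v) -> pos (minus v u) -> u = v.
Proof.
  intros H1 H2. apply minus_zero_eq, (pos_proper _ _ HX); [exact H1|].
  vreplace (opp (minus u v)) with (minus v u). exact H2.
Qed.

Lemma pos_le_trans (u v : X) : pos u -> pos (minus v u) -> pos v.
Proof.
  intros H1 H2. vreplace v with (plus u (minus v u)).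
  now apply (pos_plus _ _ HX).
Qed.

Lemma pos_lim {T} {F : (T -> Prop) -> Prop} {PF : ProperFilter F} (f : T -> X) l :
  filterlim f F (locally l) -> F (fun x => pos (f x)) -> pos l.
Proof.
  intros H K. exact (@closed_filterlim_loc T X F (Proper_StrongProper F PF) f pos l H K (pos_closed _ _ HX)).
Qed.

Lemma pos_sum (a : nat -> X) n : (forall k, (k <= n)%nat -> pos (a k)) -> pos (sum_n a n).
Proof.
  induction n as [|n IH]; intros H.
  - rewrite sum_O. now apply H.
  - rewrite sum_Sn. apply (pos_plus _ _ HX); [|now apply H].
    apply IH. intros; apply H; lia.
Qed.

Lemma pos_sum_minus_term (a : nat -> X) n j : (forall k, (k <= n)%nat -> pos (a k)) ->
  (j <= n)%nat -> pos (minus (sum_n a n) (a j)).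
Proof.
  induction n as [|n IH]; intros H Hj.
  - replace j with 0%nat by lia. rewrite sum_O. apply pos_minus_refl.
  - rewrite sum_Sn. destruct (Nat.eq_dec j (S n)) as [->|N].
    + vreplace (minus (plus (sum_n a n) (a (S n))) (a (S n))) with (sum_n a n).
      apply pos_sum. intros; apply H; lia.
    + vreplace (minus (plus (sum_n a n) (a (S n))) (a j)) with
        (plus (minus (sum_n a n) (a j)) (a (S n))).
      apply (pos_plus _ _ HX); [|now apply H]. apply IH; [|lia]. intros; apply H; lia.
Qed.

Lemma pos_sum_le (a b : nat -> X) n : (forall k, (k <= n)%nat -> pos (minus (b k) (a k))) ->
  pos (minus (sum_n b n) (sum_n a n)).
Proof.
  induction n as [|n IH]; intros H.
  - rewrite !sum_O. now apply H.
  - rewrite !sum_Sn.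
    vreplace (minus (plus (sum_n b n) (b (S n))) (plus (sum_n a n) (a (S n)))) with
      (plus (minus (sum_n b n) (sum_n a n)) (minus (b (S n)) (a (S n)))).
    apply (pos_plus _ _ HX); [|now apply H]. apply IH. intros; apply H; lia.
Qed.

Lemma pos_sum_mono (a : nat -> X) m n : (forall k, pos (a k)) -> (m <= n)%nat ->
  pos (minus (sum_n a n) (sum_n a m)).
Proof.
  intros H L. induction L as [|n L IH]; [apply pos_minus_refl|].
  rewrite sum_Sn. vreplace (minus (plus (sum_n a n) (a (S n))) (sum_n a m)) with
    (plus (minus (sum_n a n) (sum_n a m)) (a (S n))).
  now apply (pos_plus _ _ HX).
Qed.

(** Additivity of the norm on the cone identifies the sum of the norms with the norm of the partial
    sum, so bounded partial sums force absolute convergence. *)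
Lemma pos_series (a : nat -> X) c : (forall n, pos (a n)) ->
  (forall n, norm (sum_n a n) <= c) -> exists l, is_series a l.
Proof.
  intros Ha Hc. apply (ex_series_le a (fun n => norm (a n))); [intros; lra|].
  assert (E : forall n, sum_n (fun k => norm (a k)) n = norm (sum_n a n)).
  { induction n as [|n IH]; [now rewrite !sum_O|].
    rewrite !sum_Sn, IH, (pos_norm_additive _ _ HX); trivial.
    apply pos_sum. intros; apply Ha. }
  destruct (ex_finite_lim_seq_incr (sum_n (fun k => norm (a k))) c) as [l Hl].
  - intros n. rewrite sum_Sn. change plus with Rplus. generalize (norm_ge_0 (a (S n))). lra.
  - intros n. now rewrite E.
  - now exists l.
Qed.

(** Both sides sum [a j k] over the triangle j + k <= n, by antidiagonals and by rows. *)
Lemma sum_triangle (a : nat -> nat -> X) n :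
  sum_n (fun k => sum_n (fun j => a j (k - j)%nat) k) n =
  sum_n (fun j => sum_n (a j) (n - j)) n.
Proof.
  induction n as [|n IH]; [now rewrite !sum_O|].
  rewrite sum_Sn, IH, (sum_Sn _ n), (sum_Sn _ n), Nat.sub_diag, sum_O.
  rewrite (sum_n_ext_loc (fun j => sum_n (a j) (S n - j))
    (fun j => plus (sum_n (a j) (n - j)) (a j (S n - j)%nat))).
  - rewrite sum_n_plus. apply plus_assoc.
  - intros j Hj. rewrite Nat.sub_succ_l by trivial. apply sum_Sn.
Qed.

(** The triangle j + k <= n lies in the square j, k <= n, which in turn lies in the triangle j + k
    <= 2 n. The second inclusion is behind [pos_square_triangle]. *)
Lemma pos_triangle_square (a : nat -> nat -> X) n : (forall j k, pos (a j k)) ->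
  pos (minus (sum_n (fun j => sum_n (a j) n) n)
    (sum_n (fun k => sum_n (fun j => a j (k - j)%nat) k) n)).
Proof.
  intros H. rewrite sum_triangle. apply pos_sum_le. intros j Hj.
  apply pos_sum_mono; trivial. lia.
Qed.

Lemma pos_square_triangle (a : nat -> nat -> X) n : (forall j k, pos (a j k)) ->
  pos (minus (sum_n (fun k => sum_n (fun j => a j (k - j)%nat) k) (n + n))
    (sum_n (fun j => sum_n (a j) n) n)).
Proof.
  intros H. rewrite sum_triangle.
  apply (pos_minus_trans _ (sum_n (fun j => sum_n (a j) (n + n - j)) n)).
  - apply pos_sum_le. intros j Hj. apply pos_sum_mono; trivial. lia.
  - apply pos_sum_mono; [|lia]. intros j. now apply pos_sum.
Qed.

(** * Baire's argument for the decomposition into positive elements *)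

Let split_le n (z : X) := exists v w, pos v /\ pos w /\ z = minus v w /\
  norm v + norm w <= INR n.

(** The nested-ball step. [H] says that every set [split_le n] is nowhere dense. A ball is a pair of
    a centre and a radius, and positivity of the radius is a premise inside the existential so that
    [choice] can be applied to all pairs. *)
Lemma baire_step (H : forall n (x : X) r, 0 < r -> exists (y : X) eps,
    norm (minus y x) < r /\ 0 < eps /\
    forall c : X, split_le n c -> eps <= norm (minus y c)) :
  forall n (b : X * R), exists b' : X * R, 0 < snd b ->
    0 < snd b' <= snd b / 2 /\
    forall z : X, norm (minus z (fst b')) <= snd b' ->
      norm (minus z (fst b)) <= snd b /\ ~ split_le n z.
Proof.
  intros n [x r]. simpl.
  destruct (Rlt_dec 0 r) as [Hr|]; [|exists (x, r); intros; lra].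
  destruct (H n x r Hr) as [y [eps [H1 [H2 H3]]]].
  (* The three bounds make the new ball miss [split_le n], halve the radius, and keep the new ball
     inside the old one. *)
  set (r' := Rmin (eps / 2) (Rmin (r / 2) (r - norm (minus y x)))).
  exists (y, r'). intros _. simpl.
  assert (K : 0 < r' /\ r' <= eps / 2 /\ r' <= r / 2 /\ r' <= r - norm (minus y x)).
  { split; [repeat apply Rmin_glb_lt; lra|]. unfold r'.
    generalize (Rmin_l (eps / 2) (Rmin (r / 2) (r - norm (minus y x))))
      (Rmin_r (eps / 2) (Rmin (r / 2) (r - norm (minus y x))))
      (Rmin_l (r / 2) (r - norm (minus y x)))
      (Rmin_r (r / 2) (r - norm (minus y x))).
    lra. }
  split; [lra|]. intros z Hz. split.
  - generalize (norm_minus_trans z y x). lra.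
  - intros C. generalize (H3 z C). rewrite norm_minus_sym. lra.
Qed.

(** Otherwise nested balls would shrink to a point lying in no [split_le n], whereas these sets
    cover the space because the cone is generating. *)
Lemma baire_split : exists n (x : X) r, 0 < r /\ forall y : X, norm (minus y x) < r ->
  forall eps, 0 < eps -> exists c, split_le n c /\ norm (minus y c) < eps.
Proof.
  apply NNPP. intros N.
  assert (H : forall n (x : X) r, 0 < r -> exists (y : X) eps,
    norm (minus y x) < r /\ 0 < eps /\
    forall c : X, split_le n c -> eps <= norm (minus y c)).
  { intros n x r Hr. apply NNPP. intros K. apply N. exists n, x, r.
    split; trivial. intros y Hy eps He. apply NNPP. intros L.
    apply K. exists y, eps. split; trivial. split; trivial.
    intros c Hc. apply Rnot_lt_le. intros Q. apply L. now exists c. }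
  generalize (baire_step H). clear N H. intros H.
  destruct (choice (fun (nb : nat * (X * R)) (b' : X * R) => 0 < snd (snd nb) ->
    0 < snd b' <= snd (snd nb) / 2 /\
    forall z : X, norm (minus z (fst b')) <= snd b' ->
      norm (minus z (fst (snd nb))) <= snd (snd nb) /\ ~ split_le (fst nb) z))
    as [f Hf].
  { intros [n b]. apply H. }
  set (b := fix b n : X * R := match n with O => @pair X R zero 1 | S n => f (n, b n) end).
  assert (B : forall n, 0 < snd (b n)).
  { induction n as [|n IH]; simpl; [lra|]. now apply (Hf (n, b n)). }
  assert (Br : forall n, snd (b n) <= (1/2)^n).
  { induction n as [|n IH]; [simpl; lra|].
    change (snd (f (n, b n)) <= 1/2 * (1/2)^n).
    destruct (Hf (n, b n) (B n)) as [[_ K] _]. cbn [fst snd] in K.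
 lra. }
  assert (Bi : forall k n z, norm (minus z (fst (b (k + n)%nat))) <= snd (b (k + n)%nat) ->
    norm (minus z (fst (b n))) <= snd (b n)).
  { induction k as [|k IH]; intros n z Hz; trivial. apply IH.
    now apply (Hf ((k + n)%nat, b (k + n)%nat) (B _)). }
  assert (Bc : forall n m, (n <= m)%nat -> norm (minus (fst (b m)) (fst (b n))) <= snd (b n)).
  { intros n m L. apply (Bi (m - n)%nat). replace (m - n + n)%nat with m by lia.
    vreplace (minus (fst (b m)) (fst (b m))) with (@zero X).
    rewrite cnorm_zero. left; apply B. }
  destruct (cauchy_seq_lim (fun n => fst (b n))) as [l Hl].
  { intros eps He. destruct (pow_lt_1_zero (1/2)) with (y := eps / 2) as [N HN].
    { rewrite Rabs_pos_eq; lra. } { lra. }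
    exists N. intros m n Hm Hn.
    specialize (HN N (le_n N)). rewrite Rabs_pos_eq in HN by (apply pow_le; lra).
    generalize (norm_minus_trans (fst (b m)) (fst (b N)) (fst (b n))) (Bc N m Hm) (Bc N n Hn)
      (Br N). rewrite (norm_minus_sym (fst (b N))). lra. }
  assert (L : forall n, norm (minus l (fst (b n))) <= snd (b n)).
  { intros n. apply (lim_norm_le (F := eventually) (fun m => minus (fst (b m)) (fst (b n)))).
    - apply lim_minus; trivial. apply filterlim_const.
    - exists n. intros m. apply Bc. }
  destruct (pos_generating _ _ HX l) as [v [w [Hv [Hw E]]]].
  (* With [n] the integer part, the limit [l] belongs to [split_le (S n)], a set that the ball of
     index [S (S n)] avoids although it contains [l]. *)
  destruct (nfloor_ex (norm v + norm w)) as [n [_ Hn]].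
  { generalize (norm_ge_0 v) (norm_ge_0 w); lra. }
  apply (Hf (S n, b (S n)) (B _)) with (z := l).
  - apply (L (S (S n))).
  - exists v, w. cbn [fst]. rewrite S_INR. repeat split; trivial. lra.
Qed.

(** Subtracting an approximation of the centre x from one of x + y moves the ball of [baire_split]
    to the origin, at the cost of doubling the bound; homogeneity then reaches every y. *)
Lemma approx_split : exists M, 0 < M /\ forall (y : X) eps, 0 < eps ->
  exists v w, pos v /\ pos w /\ norm v + norm w <= M * norm y /\
    norm (minus y (minus v w)) < eps.
Proof.
  destruct baire_split as [n [x [r [Hr H]]]].
  assert (Hn := pos_INR n).
  (* One factor 2 comes from the two decompositions, the other from rescaling y to norm r / 2; the
     summand 1 keeps the constant positive when n = 0. *)
  exists (4 * (INR n + 1) / r). split.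
  { apply Rdiv_lt_0_compat; lra. }
  assert (K : forall y : X, norm y < r -> forall eps, 0 < eps ->
    exists v w, pos v /\ pos w /\ norm v + norm w <= 2 * INR n /\
    norm (minus y (minus v w)) < eps).
  { intros y Hy eps He.
    destruct (H (plus x y)) with (eps := eps / 2) as [c [[v [w [Hv [Hw [E L]]]]] Hc]].
    { vreplace (minus (plus x y) x) with y. trivial. } { lra. }
    destruct (H x) with (eps := eps / 2) as [c' [[v' [w' [Hv' [Hw' [E' L']]]]] Hc']].
    { vreplace (minus x x) with (@zero X). now rewrite cnorm_zero. } { lra. }
    exists (plus v w'), (plus w v'). split; [now apply (pos_plus _ _ HX)|].
    split; [now apply (pos_plus _ _ HX)|].
    split. { generalize (cnorm_triangle v w') (cnorm_triangle w v'); lra. }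
    replace (minus y (minus (plus v w') (plus w v'))) with
      (minus (minus (plus x y) c) (minus x c')) by (subst c c'; vec).
    generalize (norm_minus_le (minus (plus x y) c) (minus x c')). lra. }
  intros y eps He.
  destruct (Req_dec (norm y) 0) as [Z|NZ].
  - exists zero, zero. split; [apply (pos_zero _ _ HX)|].
    split; [apply (pos_zero _ _ HX)|]. rewrite Z, cnorm_zero, Rmult_0_r.
    split; [lra|]. vreplace (minus y (minus zero zero)) with y. lra.
  - assert (Py : 0 < norm y) by (generalize (norm_ge_0 y); lra).
    set (a := r / (2 * norm y)).
    assert (Pa : 0 < a) by (apply Rdiv_lt_0_compat; lra).
    destruct (K (scal a y)) with (eps := a * eps) as [v [w [Hv [Hw [L Q]]]]].
    { apply Rle_lt_trans with (1 := norm_scal_le _ _).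
      rewrite Rabs_pos_eq by lra. unfold a.
      replace (r / (2 * norm y) * norm y) with (r / 2) by (field; lra). lra. }
    { now apply Rmult_lt_0_compat. }
    assert (Pi : 0 < / a) by now apply Rinv_0_lt_compat.
    exists (scal (/ a) v), (scal (/ a) w).
    split; [apply (pos_scal _ _ HX); trivial; lra|].
    split; [apply (pos_scal _ _ HX); trivial; lra|]. split.
    + apply Rle_trans with (/ a * (2 * INR n)).
      * generalize (norm_scal_le (/ a) v) (norm_scal_le (/ a) w).
        rewrite Rabs_pos_eq by lra. intros.
        apply Rle_trans with (/ a * (norm v + norm w)); [lra|].
        apply Rmult_le_compat_l; lra.
      * unfold a. replace (/ (r / (2 * norm y)) * (2 * INR n))
          with ((4 * INR n) / r * norm y) by (field; lra).
        apply Rmult_le_compat_r; [lra|]. apply Rmult_le_compat_r; [|lra].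
        left; now apply Rinv_0_lt_compat.
    + vreplace (minus y (minus (scal (/ a) v) (scal (/ a) w))) with
        (scal (/ a) (minus (scal a y) (minus v w))).
      apply Rle_lt_trans with (1 := norm_scal_le _ _).
      rewrite Rabs_pos_eq by lra.
      apply Rmult_lt_reg_l with a; trivial. rewrite <- Rmult_assoc, Rinv_r, Rmult_1_l by lra. exact Q.
Qed.

Lemma is_series_half c : is_series (fun n => c * (1/2)^n) (2 * c).
Proof.
  replace (2 * c) with (scal (V := R_NormedModule) c (/ (1 - 1/2))).
  - apply (is_series_scal (V := R_NormedModule) c), is_series_geom.
    rewrite Rabs_pos_eq; lra.
  - change (c * / (1 - 1/2) = 2 * c). field.
Qed.

Lemma sum_half_le c n : 0 <= c -> sum_n (fun k => c * (1/2)^k) n <= 2 * c.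
Proof.
  intros Hc. assert (sum_n (fun k => c * (1/2)^k) n = 2 * c - c * (1/2)^n).
  { induction n as [|n IH]; [rewrite sum_O; simpl; lra|].
    rewrite sum_Sn, IH. change plus with Rplus. simpl. lra. }
  assert (0 <= c * (1/2)^n) by (apply Rmult_le_pos; [|apply pow_le]; lra). lra.
Qed.

(* The open mapping theorem for (v, w) |-> v - w: Baire's argument gives
   approximate decompositions, which are summed along a geometric series. *)
Lemma bounded_decomposition : exists M, 0 < M /\ forall u : X,
  exists v w, pos v /\ pos w /\ u = minus v w /\ norm v + norm w <= M * norm u.
Proof.
  destruct approx_split as [M [HM H]].
  (* Each of the two series of positive elements has norm at most 2 * (M * norm u), by the geometric
     series of ratio 1/2. *)
  exists (4 * M). split; [lra|]. intros u.
  destruct (Req_dec (norm u) 0) as [Z|NZ].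
  { exists zero, zero. split; [apply (pos_zero _ _ HX)|].
    split; [apply (pos_zero _ _ HX)|]. rewrite cnorm_zero, Z. split; [|lra].
    rewrite (cnorm_eq_zero _ Z). vec. }
  assert (Pu : 0 < norm u) by (generalize (norm_ge_0 u); lra).
  destruct (choice (fun (q : X * R) (p : X * X) => 0 < snd q ->
    pos (fst p) /\ pos (snd p) /\ norm (fst p) + norm (snd p) <= M * norm (fst q) /\
    norm (minus (fst q) (minus (fst p) (snd p))) < snd q)) as [f Hf].
  { intros [y eps]. destruct (Rlt_dec 0 eps) as [He|]; [|exists (zero, zero); simpl; lra].
    destruct (H y eps He) as [v [w K]]. now exists (v, w). }
  set (e n := norm u * (1/2)^(S n)).
  assert (He : forall n, 0 < e n).
  { intros n. apply Rmult_lt_0_compat; trivial. apply pow_lt; lra. }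
  (* [y n] is the remainder after n approximate decompositions; the tolerance [e n] makes its norm
     at most norm u / 2^n. *)
  set (y := fix y n : X := match n with O => u | S n =>
     let p := f (y n, e n) in minus (y n) (minus (fst p) (snd p)) end).
  set (p n := f (y n, e n)).
  assert (Hy : forall n, norm (y n) <= norm u * (1/2)^n).
  { intros [|n]; [simpl; lra|]. left. apply (Hf (y n, e n) (He n)). }
  assert (Hv : forall n, pos (fst (p n))) by (intros n; apply (Hf (y n, e n) (He n))).
  assert (Hw : forall n, pos (snd (p n))) by (intros n; apply (Hf (y n, e n) (He n))).
  assert (Hn : forall n, norm (fst (p n)) + norm (snd (p n)) <= M * norm u * (1/2)^n).
  { intros n. apply Rle_trans with (M * norm (y n)).
    - apply (Hf (y n, e n) (He n)).
    - rewrite Rmult_assoc. apply Rmult_le_compat_l; [lra|apply Hy]. }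
  assert (Hnv : forall n, norm (fst (p n)) <= M * norm u * (1/2)^n).
  { intros n. generalize (Hn n) (norm_ge_0 (snd (p n))); lra. }
  assert (Hnw : forall n, norm (snd (p n)) <= M * norm u * (1/2)^n).
  { intros n. generalize (Hn n) (norm_ge_0 (fst (p n))); lra. }
  assert (SB : ex_series (fun n => M * norm u * (1/2)^n)) by (eexists; apply is_series_half).
  destruct (ex_series_le _ _ Hnv SB) as [v Lv].
  destruct (ex_series_le _ _ Hnw SB) as [w Lw].
  exists v, w.
  assert (B : forall q : nat -> X, (forall n, norm (q n) <= M * norm u * (1/2)^n) ->
    forall n, norm (sum_n q n) <= 2 * (M * norm u)).
  { intros q Hq n. apply Rle_trans with (sum_n (fun k => M * norm u * (1/2)^k) n).
    - clear -Hq. induction n as [|n IH]; [rewrite !sum_O; apply Hq|].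
      rewrite !sum_Sn. apply Rle_trans with (1 := cnorm_triangle _ _).
      apply Rplus_le_compat; [apply IH|apply Hq].
    - apply sum_half_le. apply Rmult_le_pos; lra. }
  split. { apply (pos_lim _ _ Lv). apply filter_forall. intros n. now apply pos_sum. }
  split. { apply (pos_lim _ _ Lw). apply filter_forall. intros n. now apply pos_sum. }
  split.
  - apply (lim_unique (F := eventually)
      (fun n => minus (sum_n (fun n => fst (p n)) n) (sum_n (fun n => snd (p n)) n)));
      [|now apply lim_minus].
    assert (St : forall n, minus (sum_n (fun n => fst (p n)) n) (sum_n (fun n => snd (p n)) n)
      = minus u (y (S n))).
    { induction n as [|n IH].
      - rewrite !sum_O. unfold p. simpl. vec.
      - rewrite !sum_Sn.
        transitivity (plus (minus (sum_n (fun n => fst (p n)) n)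
           (sum_n (fun n => snd (p n)) n)) (minus (fst (p (S n))) (snd (p (S n))))); [vec|].
        rewrite IH. change (y (S (S n))) with
          (minus (y (S n)) (minus (fst (p (S n))) (snd (p (S n))))). vec. }
    apply lim_zero_le with (g := fun n => norm u / 2 * (1/2)^n).
    + apply filter_forall. intros n. rewrite St, norm_minus_sym.
      vreplace (minus u (minus u (y (S n)))) with (y (S n)).
      generalize (Hy (S n)). simpl. lra.
    + apply limR_zero_scal. refine (is_lim_seq_geom (1/2) _).
      rewrite Rabs_pos_eq; lra.
  - assert (norm v <= 2 * (M * norm u)).
    { apply (lim_norm_le _ _ _ Lv), filter_forall, B, Hnv. }
    assert (norm w <= 2 * (M * norm u)).
    { apply (lim_norm_le _ _ _ Lw), filter_forall, B, Hnw. }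
    lra.
Qed.

End Cone.

(** * Right derivatives and integrals *)

Lemma at_right_0_iff (P : R -> Prop) :
  at_right 0 P <-> exists d, 0 < d /\ forall h, 0 < h < d -> P h.
Proof.
  split.
  - intros [d Hd]. exists d. split; [apply cond_pos|]. intros h [H1 H2].
    apply Hd; trivial. change (Rabs (h - 0) < d). rewrite Rminus_0_r, Rabs_pos_eq; lra.
  - intros [d [Hd H]]. exists (mkposreal d Hd). intros h Hh Hp. apply H. split; trivial.
    change (Rabs (h - 0) < d) in Hh. rewrite Rminus_0_r, Rabs_pos_eq in Hh; lra.
Qed.

Lemma at_right_0_pos : at_right 0 (fun h => 0 < h).
Proof. apply at_right_0_iff. exists 1. split; [lra|]. intros; lra. Qed.

Section Calculus.
Context {V : CompleteNormedModule R_AbsRing}.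

Lemma continuous_iff (f : R -> V) t :
  continuous f t <-> forall eps, 0 < eps -> exists d, 0 < d /\
    forall s, Rabs (s - t) < d -> norm (minus (f s) (f t)) < eps.
Proof.
  unfold continuous. split.
  - intros H eps He. destruct (proj1 (lim_norm_iff f (f t)) H eps He) as [d Hd].
    exists d. split; [apply cond_pos|]. intros s Hs. now apply Hd.
  - intros H. apply (proj2 (lim_norm_iff f (f t))). intros eps He.
    destruct (H eps He) as [d [Hd K]]. exists (mkposreal d Hd). intros s Hs. now apply K.
Qed.

Lemma continuous_RInt_exists (f : R -> V) a b :
  (forall t, continuous f t) -> is_RInt f a b (RInt f a b).
Proof. intros H. apply RInt_correct. apply ex_RInt_continuous. intros; apply H. Qed.

Lemma is_RInt_linear {W : CompleteNormedModule R_AbsRing} (L : V -> W) (f : R -> V) a b l :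
  is_linear L -> is_RInt f a b l -> is_RInt (fun t => L (f t)) a b (L l).
Proof.
  intros HL H. unfold is_RInt in *.
  apply filterlim_ext with
    (fun ptd => L (scal (sign (b - a)) (Riemann_sum f ptd))).
  - intros ptd. rewrite (linear_scal L HL). f_equal.
    induction ptd as [x0|h s IH] using SF_cons_ind.
    + exact (clinear_zero L HL).
    + rewrite !Riemann_sum_cons, <- IH, <- (linear_scal L HL).
      apply (linear_plus L HL).
  - apply lim_linear; trivial.
Qed.

Lemma is_RInt_minus' (f g : R -> V) a b k l : is_RInt f a b k -> is_RInt g a b l ->
  is_RInt (fun t => minus (f t) (g t)) a b (minus k l).
Proof. intros Hf Hg. exact (is_RInt_minus f g a b k l Hf Hg). Qed.

Lemma is_RInt_plus' (f g : R -> V) a b k l : is_RInt f a b k -> is_RInt g a b l ->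
  is_RInt (fun t => plus (f t) (g t)) a b (plus k l).
Proof. intros Hf Hg. exact (is_RInt_plus f g a b k l Hf Hg). Qed.

Lemma is_RInt_scal' (c : R) (f : R -> V) a b l : is_RInt f a b l ->
  is_RInt (fun t => scal c (f t)) a b (scal c l).
Proof. intros Hf. exact (is_RInt_scal f a b c l Hf). Qed.

Lemma is_RInt_sum_n (f : nat -> R -> V) a b l n :
  (forall k, (k <= n)%nat -> is_RInt (f k) a b (l k)) ->
  is_RInt (fun t => sum_n (fun k => f k t) n) a b (sum_n l n).
Proof.
  induction n as [|n IH]; intros H.
  - rewrite sum_O. apply is_RInt_ext with (f 0%nat); [|now apply H].
    intros x _. now rewrite sum_O.
  - rewrite sum_Sn.
    apply is_RInt_ext with (fun t => plus (sum_n (fun k => f k t) n) (f (S n) t)).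
    + intros x _. now rewrite sum_Sn.
    + apply is_RInt_plus'; [apply IH; intros; apply H; lia|now apply H].
Qed.

Lemma is_RInt_functional (f : R -> V) a b k l :
  is_RInt f a b k -> is_RInt f a b l -> k = l.
Proof. intros Hk Hl. now rewrite <- (is_RInt_unique f a b k), <- (is_RInt_unique f a b l). Qed.

(** One-sided, because a generator is a limit at 0 from the right; continuity of the function
    compensates for the missing left derivative. *)
Definition rderiv (f : R -> V) (t : R) (l : V) : Prop :=
  filterlim (fun h => scal (/ h) (minus (f (t + h)) (f t))) (at_right 0) (locally l).

Lemma rderiv_iff (f : R -> V) t l : rderiv f t l <->
  forall eps, 0 < eps -> exists d, 0 < d /\ forall h, 0 < h < d ->
    norm (minus (minus (f (t + h)) (f t)) (scal h l)) <= h * eps.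
Proof.
  split; intros H.
  - intros eps He.
    destruct (proj1 (at_right_0_iff _) (proj1 (lim_norm_iff _ l) H eps He)) as [d [Hd K]].
    exists d. split; trivial. intros h Hh.
    vreplace (minus (minus (f (t + h)) (f t)) (scal h l)) with
      (scal h (minus (scal (/ h) (minus (f (t + h)) (f t))) l)).
    apply Rle_trans with (1 := norm_scal_le _ _). rewrite Rabs_pos_eq by lra.
    apply Rmult_le_compat_l; [lra|]. left. now apply K.
  - apply (proj2 (lim_norm_iff _ l)). intros eps He.
    apply at_right_0_iff. destruct (H (eps / 2) ltac:(lra)) as [d [Hd K]].
    exists d. split; trivial. intros h Hh.
    vreplace (minus (scal (/ h) (minus (f (t + h)) (f t))) l) with
      (scal (/ h) (minus (minus (f (t + h)) (f t)) (scal h l))).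
    apply Rle_lt_trans with (1 := norm_scal_le _ _).
    assert (0 < / h) by (apply Rinv_0_lt_compat; lra).
    rewrite Rabs_pos_eq by lra.
    apply Rle_lt_trans with (/ h * (h * (eps / 2))).
    + apply Rmult_le_compat_l; [lra|]. now apply K.
    + rewrite <- Rmult_assoc, Rinv_l by lra. lra.
Qed.

Lemma rderiv_minus (f g : R -> V) t k l :
  rderiv f t k -> rderiv g t l -> rderiv (fun s => minus (f s) (g s)) t (minus k l).
Proof.
  intros Hf Hg. apply filterlim_ext with (fun h =>
    minus (scal (/ h) (minus (f (t + h)) (f t))) (scal (/ h) (minus (g (t + h)) (g t)))).
  - intros h. vec.
  - now apply lim_minus.
Qed.

Lemma rderiv_RInt (f : R -> V) a t :
  (forall t, continuous f t) -> rderiv (fun s => RInt f a s) t (f t).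
Proof.
  intros Hf. apply rderiv_iff. intros eps He.
  destruct (proj1 (continuous_iff f t) (Hf t) eps He) as [d [Hd K]].
  exists d. split; trivial. intros h Hh.
  assert (H1 := continuous_RInt_exists f a t Hf).
  assert (H2 := continuous_RInt_exists f t (t + h) Hf).
  rewrite (is_RInt_unique _ _ _ _ (is_RInt_Chasles f a t (t + h) _ _ H1 H2)).
  vreplace (minus (minus (plus (RInt f a t) (RInt f t (t + h))) (RInt f a t))
    (scal h (f t))) with (minus (RInt f t (t + h)) (scal (t + h - t) (f t))).
  replace (h * eps) with ((t + h - t) * eps) by ring.
  apply norm_RInt_le_const with (f := fun s => minus (f s) (f t)); [lra| |].
  - intros s Hs. left. apply K. rewrite Rabs_pos_eq; lra.
  - apply is_RInt_minus'; trivial. exact (@is_RInt_const V t (t + h) (f t)).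
Qed.

Lemma is_RInt_difference (f : R -> V) c a b : (forall t, continuous f t) ->
  is_RInt f a b (minus (RInt f c b) (RInt f c a)).
Proof.
  intros Hf.
  vreplace (minus (RInt f c b) (RInt f c a)) with (plus (opp (RInt f c a)) (RInt f c b)).
  refine (@is_RInt_Chasles V f a c b _ _ (is_RInt_swap f a c _ _) _);
    now apply continuous_RInt_exists.
Qed.

Lemma continuous_RInt_upper (f : R -> V) a t :
  (forall t, continuous f t) -> continuous (fun s => RInt f a s) t.
Proof.
  intros Hf. apply (continuous_RInt_1 f a t (fun s => RInt f a s)).
  apply filter_forall. intros s. now apply continuous_RInt_exists.
Qed.

(* The set of [t] with [norm (k s - k a) <= eps (s - a)] for all [s <= t] is closed
   by continuity and can be prolonged to the right. *)
Lemma rderiv_zero_const (k : R -> V) a b :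
  a <= b -> (forall t, continuous k t) ->
  (forall t, a <= t < b -> rderiv k t zero) -> k b = k a.
Proof.
  intros Hab Hc Hd. destruct (Rle_lt_or_eq_dec a b Hab) as [Lab|E]; [|now rewrite E].
  apply norm_small_eq. intros eps' He'.
  set (eps := eps' / (b - a)).
  assert (He : 0 < eps) by (apply Rdiv_lt_0_compat; lra).
  set (E t := a <= t <= b /\
    forall s, a <= s <= t -> norm (minus (k s) (k a)) <= eps * (s - a)).
  assert (Ea : E a).
  { split; [lra|]. intros s Hs. replace s with a by lra.
    vreplace (minus (k a) (k a)) with (@zero V). rewrite cnorm_zero. lra. }
  destruct (completeness E) as [m [Hm1 Hm2]].
  { exists b. intros t [Ht _]. lra. } { now exists a. }
  assert (Ham : a <= m) by now apply Hm1.
  assert (Hmb : m <= b) by (apply Hm2; intros t [Ht _]; lra).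
  assert (B : forall s, a <= s < m -> norm (minus (k s) (k a)) <= eps * (s - a)).
  { intros s Hs. apply NNPP. intros N. apply (Rlt_not_le m s); [lra|].
    apply Hm2. intros t [Ht1 Ht2]. apply Rnot_lt_le. intros L. apply N, Ht2. lra. }
  assert (Em : E m).
  { split; [lra|]. intros s Hs. destruct (Rlt_dec s m) as [L|L]; [apply B; lra|].
    replace s with m by lra. clear s Hs L. apply Rnot_lt_le. intros L.
    assert (Lam : a < m).
    { destruct (Req_dec a m) as [<-|]; [|lra]. exfalso.
      destruct Ea as [_ Ea]. generalize (Ea a). lra. }
    destruct (proj1 (continuous_iff k m) (Hc m)
      (norm (minus (k m) (k a)) - eps * (m - a)) ltac:(lra)) as [d [Hd0 K]].
    set (s := Rmax a (m - d / 2)).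
    assert (Hs : a <= s < m /\ m - s < d).
    { unfold s. apply Rmax_case_strong; intros; lra. }
    specialize (K s). rewrite Rabs_left in K by lra.
    generalize (norm_minus_trans (k m) (k s) (k a)) (B s (proj1 Hs)) (K ltac:(lra)).
    rewrite (norm_minus_sym (k s) (k m)).
    assert (eps * (s - a) < eps * (m - a)) by (apply Rmult_lt_compat_l; lra). lra. }
  destruct (Req_dec m b) as [->|Nb].
  { destruct Em as [_ Em]. replace eps' with (eps * (b - a)); [apply Em; lra|].
    unfold eps. field. lra. }
  exfalso.
  destruct (proj1 (rderiv_iff k m zero) (Hd m ltac:(lra)) eps He) as [d [Hd0 K]].
  set (h := Rmin (d / 2) (b - m)).
  assert (Hh : 0 < h < d /\ m + h <= b).
  { unfold h. apply Rmin_case_strong; intros; lra. }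
  enough (Emh : E (m + h)) by (generalize (Hm1 _ Emh); lra).
  split; [lra|]. intros s Hs.
  destruct (Rle_dec s m) as [L|L]; [now apply Em|].
  assert (K' := K (s - m) ltac:(lra)). replace (m + (s - m)) with s in K' by ring.
  revert K'. vreplace (minus (minus (k s) (k m)) (scal (s - m) zero)) with (minus (k s) (k m)).
  destruct Em as [_ Em].
  generalize (norm_minus_trans (k s) (k m) (k a)) (Em m ltac:(lra)). lra.
Qed.

(** The difference between f and the integral of its right derivative g is continuous with right
    derivative zero, hence constant. *)
Lemma is_RInt_rderiv (f g : R -> V) a b :
  a <= b -> (forall t, continuous f t) -> (forall t, continuous g t) ->
  (forall t, a <= t < b -> rderiv f t (g t)) ->
  is_RInt g a b (minus (f b) (f a)).
Proof.
  intros Hab Hf Hg Hd.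
  assert (E : minus (f b) (RInt g a b) = minus (f a) (RInt g a a)).
  { apply (rderiv_zero_const (fun t => minus (f t) (RInt g a t))); trivial.
    - intros t. apply lim_minus; [apply Hf|]. now apply continuous_RInt_upper.
    - intros t Ht. replace (@zero V) with (minus (g t) (g t)) by vec.
      apply rderiv_minus; [now apply Hd|]. now apply rderiv_RInt. }
  rewrite RInt_point in E.
  replace (minus (f b) (f a)) with (RInt g a b); [now apply continuous_RInt_exists|].
  apply minus_zero_eq.
  vreplace (minus (RInt g a b) (minus (f b) (f a))) with
    (minus (f a) (minus (f b) (RInt g a b))).
  rewrite E. vec.
Qed.

(* Families are arbitrary at negative times; composed with [Rmax 0] they become
   continuous on all of R. *)
Lemma continuous_from_modulus (f : R -> V) (om : R -> R) :
  (forall t h, 0 <= t -> 0 < h -> norm (minus (f (t + h)) (f t)) <= om h) ->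
  filterlim om (at_right 0) (locally 0) ->
  forall t, continuous (fun s => f (Rmax 0 s)) t.
Proof.
  intros Hf Ho t. apply continuous_iff. intros eps He.
  destruct (proj1 (at_right_0_iff _) (proj1 (filterlim_locally om 0) Ho (mkposreal eps He)))
    as [d [Hd K]].
  assert (H : forall p q, 0 <= p -> p < q < p + d -> norm (minus (f q) (f p)) < eps).
  { intros p q Hp Hq. assert (Q := K (q - p) ltac:(lra)).
    change (Rabs (om (q - p) - 0) < eps) in Q. rewrite Rminus_0_r in Q.
    generalize (Rle_abs (om (q - p))) (Hf p (q - p) Hp ltac:(lra)).
    replace (p + (q - p)) with q by ring. lra. }
  exists d. split; trivial. intros s Hs.
  assert (B : Rabs (Rmax 0 s - Rmax 0 t) < d /\ 0 <= Rmax 0 s /\ 0 <= Rmax 0 t).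
  { split; [|split; apply Rmax_l]. apply Rle_lt_trans with (2 := Hs).
    unfold Rmax, Rabs.
    repeat (destruct Rle_dec || destruct Rcase_abs); lra. }
  revert B. generalize (Rmax 0 s) (Rmax 0 t). intros p q [B [Hp Hq]].
  apply Rabs_def2 in B. destruct (Rtotal_order p q) as [L|[->|L]].
  - rewrite norm_minus_sym. apply H; lra.
  - vreplace (minus (f q) (f q)) with (@zero V). now rewrite cnorm_zero.
  - apply H; lra.
Qed.

End Calculus.

(** * Positivity and shifts of integrals *)

Lemma pos_RInt {X : CompleteNormedModule R_AbsRing} {pos : X -> Prop}
    (HX : is_abstract_state_space X pos) (f : R -> X) a b l :
  a <= b -> (forall t, pos (f t)) -> is_RInt f a b l -> pos l.
Proof.
  intros Hab Hf H. unfold is_RInt in H.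
  apply (pos_lim HX (F := Riemann_fine a b) _ _ H).
  unfold Riemann_fine, within. apply filter_forall. intros ptd [P _].
  apply (pos_scal _ _ HX).
  (* [is_RInt] multiplies the Riemann sums by [sign (b - a)], which vanishes when a = b. *)
  { destruct Hab as [L| ->]; [rewrite sign_eq_1; lra|rewrite Rminus_diag, sign_0; lra]. }
  revert P. induction ptd as [x0|h s IH] using SF_cons_ind; intros P.
  - apply (pos_zero _ _ HX).
  - rewrite Riemann_sum_cons. apply (pos_plus _ _ HX).
    + apply (pos_scal _ _ HX); trivial.
      generalize (P 0%nat). unfold SF_size. simpl. intros Q.
      specialize (Q ltac:(lia)). simpl in Q. unfold SF_h in *; simpl in *; lra.
    + apply IH. now apply ptd_cons with h.
Qed.

(** Clamping the argument to [a, b] makes the integrand positive everywhere and leaves the integral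
    unchanged. *)
Lemma pos_RInt_on {X : CompleteNormedModule R_AbsRing} {pos : X -> Prop}
    (HX : is_abstract_state_space X pos) (f : R -> X) a b l :
  a <= b -> (forall t, a <= t <= b -> pos (f t)) -> is_RInt f a b l -> pos l.
Proof.
  intros Hab Hf H.
  apply (pos_RInt HX (fun t => f (Rmax a (Rmin b t))) a b l Hab).
  - intros t. apply Hf. unfold Rmax, Rmin.
    repeat (destruct Rle_dec); lra.
  - apply is_RInt_ext with (2 := H). intros t.
    rewrite (Rmin_left a b), (Rmax_right a b) by trivial. intros Ht.
    rewrite Rmin_right, Rmax_right by lra. trivial.
Qed.

Lemma is_RInt_shift {V : CompleteNormedModule R_AbsRing} (f : R -> V) c a b l :
  is_RInt f (a + c) (b + c) l -> is_RInt (fun t => f (t + c)) a b l.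
Proof.
  intros H. apply is_RInt_ext with (fun t => scal 1 (f (1 * t + c))).
  - intros t _. rewrite Rmult_1_l. vec.
  - apply (is_RInt_comp_lin f 1 c a b l). now rewrite !Rmult_1_l.
Qed.

Lemma at_right_shift (t : R) :
  filterlim (fun h => t + h) (at_right 0) (locally t).
Proof.
  apply filterlim_locally. intros eps. apply at_right_0_iff.
  exists eps. split; [apply cond_pos|]. intros h Hh.
  change (Rabs (t + h - t) < eps). rewrite Rabs_pos_eq; lra.
Qed.

Lemma rderiv_affine {V : CompleteNormedModule R_AbsRing} (g : R -> V) a b t l :
  continuous g t -> rderiv g t l ->
  rderiv (fun s => scal (a + b * s) (g s)) t (plus (scal (a + b * t) l) (scal b (g t))).
Proof.
  intros Hc Hg.
  apply filterlim_ext_loc with (fun h =>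
    plus (scal (a + b * t) (scal (/ h) (minus (g (t + h)) (g t)))) (scal b (g (t + h)))).
  - apply at_right_0_iff. exists 1. split; [lra|]. intros h Hh. vec.
  - apply lim_plus.
    + now apply lim_scal.
    + apply lim_scal. exact (filterlim_comp _ _ _ _ _ _ _ _ (at_right_shift t) Hc).
Qed.

(** * Substochastic semigroups *)

Section StateSpace.
Context {X : CompleteNormedModule R_AbsRing} {pos : X -> Prop}.
Hypothesis HX : is_abstract_state_space X pos.
Context {M : R}.
Hypothesis HM : 0 < M.
Hypothesis Hdec : forall u : X,
  exists v w, pos v /\ pos w /\ u = minus v w /\ norm v + norm w <= M * norm u.

(** The decomposition u = v - w transports a bound from the cone at the price of a factor [M]. Only
    compatibility with [minus] is asked, since the lemma also serves for maps whose boundedness is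
    still unknown, such as [B] composed with an integral of an orbit. *)
Lemma cone_bound {Y : CompleteNormedModule R_AbsRing} (L : X -> Y) c :
  0 <= c -> (forall u v, L (minus u v) = minus (L u) (L v)) ->
  (forall u, pos u -> norm (L u) <= c * norm u) ->
  forall u, norm (L u) <= c * M * norm u.
Proof.
  intros Hc HL H u. destruct (Hdec u) as [v [w [Hv [Hw [-> K]]]]]. rewrite HL.
  apply Rle_trans with (1 := norm_minus_le _ _).
  apply Rle_trans with (c * norm v + c * norm w).
  { apply Rplus_le_compat; auto. }
  rewrite <- Rmult_plus_distr_l, Rmult_assoc. now apply Rmult_le_compat_l.
Qed.

Lemma linear_cone_eq (L L' : X -> X) : is_linear L -> is_linear L' ->
  (forall u, pos u -> L u = L' u) -> forall u, L u = L' u.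
Proof.
  intros HL HL' H u. destruct (Hdec u) as [v [w [Hv [Hw [-> _]]]]].
  now rewrite (clinear_minus L), (clinear_minus L'), !H.
Qed.

(** What a family must satisfy to be put into the Duhamel integral. There is no semigroup law,
    because the Dyson-Phillips terms of positive index obey the addition formula of [dp_add] in its
    place. *)
Record tame (S : R -> X -> X) : Prop := {
  tame_linear : forall t, 0 <= t -> is_linear (S t);
  tame_pos : forall t u, 0 <= t -> pos u -> pos (S t u);
  tame_contr : forall t u, 0 <= t -> pos u -> norm (S t u) <= norm u;
  tame_cont : forall u t, continuous (fun s => S (Rmax 0 s) u) t
}.

Lemma cone_contraction_bound (L : X -> X) : is_linear L ->
  (forall u, pos u -> norm (L u) <= norm u) -> forall u, norm (L u) <= M * norm u.
Proof.
  intros HL H u. rewrite <- (Rmult_1_l M). apply cone_bound; [lra| |].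
  - intros; now apply clinear_minus.
  - intros; rewrite Rmult_1_l; auto.
Qed.

Lemma tame_bound S t u : tame S -> 0 <= t -> norm (S t u) <= M * norm u.
Proof.
  intros HS Ht. apply cone_contraction_bound.
  - now apply HS.
  - intros; now apply (tame_contr S HS).
Qed.

(** The uniform bound [M] upgrades strong continuity of S to continuity along a moving argument. *)
Lemma tame_conv_continuous S (f : R -> X) t : tame S ->
  (forall s, continuous f s) ->
  forall s, continuous (fun s => S (Rmax 0 (t - s)) (f s)) s.
Proof.
  intros HS Hf s.
  apply (lim_equicontinuous (fun s => S (Rmax 0 (t - s))) f (f s) _ M).
  - apply filter_forall. intros r u v. symmetry. apply clinear_minus, HS, Rmax_l.
  - apply filter_forall. intros r u. apply tame_bound; trivial. apply Rmax_l.
  - apply Hf.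
  - assert (C : continuous (fun r => t - r) s).
    { apply (continuous_minus (V := R_NormedModule) (fun _ => t) (fun r => r)).
      - apply continuous_const.
      - apply continuous_id. }
    apply (filterlim_comp _ _ _ _ _ _ _ _ C (tame_cont S HS (f s) (t - s))).
Qed.

(** * A single semigroup and its generator *)

Section Semigroup.
Variable T : R -> X -> X.
Hypothesis HT : is_substochastic_C0_semigroup X pos T.

Lemma sg_lin t : 0 <= t -> is_linear (T t).
Proof. apply (sg_linear _ _ (sub_semigroup _ _ _ HT)). Qed.

Lemma sg_add s t u : 0 <= s -> 0 <= t -> T (s + t) u = T s (T t u).
Proof. apply (sg_plus _ _ (sub_semigroup _ _ _ HT)). Qed.

Lemma sg_id u : T 0 u = u.
Proof. apply (sg_zero _ _ (sub_semigroup _ _ _ HT)). Qed.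

Lemma sg_norm t u : 0 <= t -> norm (T t u) <= M * norm u.
Proof.
  intros Ht. apply cone_contraction_bound.
  - now apply sg_lin.
  - intros; now apply (sub_contractive _ _ _ HT).
Qed.

Lemma semigroup_tame : tame T.
Proof.
  split.
  - apply sg_lin.
  - apply HT.
  - apply HT.
  (* T(t+h) u - T(t) u = T(t) (T(h) u - u), so continuity at 0 provides a modulus that is uniform in
     t. *)
  - intros u. refine (continuous_from_modulus (fun s => T s u)
      (fun h => M * norm (minus (T h u) u)) _ _).
    + intros t h Ht Hh. rewrite sg_add, <- clinear_minus by (try apply sg_lin; lra).
      now apply sg_norm.
    + apply limR_zero_scal, lim_norm_zero. apply (sg_continuous _ _ (sub_semigroup _ _ _ HT)).
Qed.

Lemma orbit_cont u t : continuous (fun s => T (Rmax 0 s) u) t.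
Proof. apply (tame_cont _ semigroup_tame). Qed.

Lemma generator_graph_unique u v w :
  generator_graph X T u v -> generator_graph X T u w -> v = w.
Proof. apply lim_unique. Qed.

Lemma generator_graph_plus u v u' v' : generator_graph X T u v ->
  generator_graph X T u' v' -> generator_graph X T (plus u u') (plus v v').
Proof.
  intros H H'. apply filterlim_ext_loc with (2 := lim_plus _ _ _ _ H H').
  generalize at_right_0_pos. apply filter_imp. intros h Hh.
  rewrite (linear_plus (T h)) by (apply sg_lin; lra). vec.
Qed.

Lemma generator_graph_scal c u v : generator_graph X T u v ->
  generator_graph X T (scal c u) (scal c v).
Proof.
  intros H. apply filterlim_ext_loc with (2 := lim_scal c _ _ H).
  generalize at_right_0_pos. apply filter_imp. intros h Hh.
  rewrite (linear_scal (T h)) by (apply sg_lin; lra). vec.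
Qed.

Lemma rderiv_orbit u v t : 0 <= t -> generator_graph X T u v ->
  rderiv (fun s => T (Rmax 0 s) u) t (T t v).
Proof.
  intros Ht H. apply filterlim_ext_loc with (2 := lim_linear (T t) _ _ (sg_lin t Ht) H).
  generalize at_right_0_pos. apply filter_imp. intros h Hh.
  rewrite !Rmax_right by lra. rewrite (linear_scal (T t)), clinear_minus, sg_add
    by (try apply sg_lin; lra). trivial.
Qed.

Lemma generator_graph_orbit u v t : 0 <= t -> generator_graph X T u v ->
  generator_graph X T (T t u) (T t v).
Proof.
  intros Ht H. apply filterlim_ext_loc with (2 := rderiv_orbit u v t Ht H).
  generalize at_right_0_pos. apply filter_imp. intros h Hh.
  rewrite !Rmax_right by lra. now rewrite (Rplus_comm t h), sg_add by lra.
Qed.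

(** Affine weights cover both integrals in the representation of the domain, with weights 1 and 1 -
    s, as well as the means of orbits. The value is in the domain for every u, and in the cone if u
    is and the weight is nonnegative. *)
Definition wint (a b tau : R) (u : X) : X :=
  RInt (fun s => scal (a + b * s) (T (Rmax 0 s) u)) 0 tau.

Lemma wint_integrand_cont a b u t : continuous (fun s => scal (a + b * s) (T (Rmax 0 s) u)) t.
Proof.
  apply (continuous_scal (fun s => a + b * s) (fun s => T (Rmax 0 s) u)).
  - apply (continuous_plus (V := R_NormedModule) (fun _ => a) (fun s => b * s)).
    + apply continuous_const.
    + apply (continuous_scal_r (V := R_NormedModule) b (fun s => s)), continuous_id.
  - apply orbit_cont.
Qed.

Lemma wint_correct a b tau u :
  is_RInt (fun s => scal (a + b * s) (T (Rmax 0 s) u)) 0 tau (wint a b tau u).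
Proof. apply continuous_RInt_exists. intros; apply wint_integrand_cont. Qed.

Lemma wint_minus a b tau u v :
  wint a b tau (minus u v) = minus (wint a b tau u) (wint a b tau v).
Proof.
  apply is_RInt_unique.
  apply is_RInt_ext with (2 := is_RInt_minus' _ _ _ _ _ _
    (wint_correct a b tau u) (wint_correct a b tau v)).
  intros s _. rewrite clinear_minus by apply sg_lin, Rmax_l. vec.
Qed.

Lemma wint_scal a b tau c u : wint a b tau (scal c u) = scal c (wint a b tau u).
Proof.
  apply is_RInt_unique.
  apply is_RInt_ext with (2 := is_RInt_scal' c _ _ _ _ (wint_correct a b tau u)).
  intros s _. rewrite (linear_scal (T _)) by apply sg_lin, Rmax_l. vec.
Qed.

Lemma wint_pos a b tau u : 0 <= tau -> (forall s, 0 <= s <= tau -> 0 <= a + b * s) ->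
  pos u -> pos (wint a b tau u).
Proof.
  intros Ht Hab Hu. apply (pos_RInt_on HX _ 0 tau _ Ht) with (2 := wint_correct a b tau u).
  intros s Hs. apply (pos_scal _ _ HX); [now apply Hab|].
  apply HT; trivial. apply Rmax_l.
Qed.

(** Integration by parts: the generator produces the boundary terms of the weighted orbit, minus the
    orbit integrated against the derivative [b] of the weight. *)
Lemma generator_graph_wint a b tau u : 0 <= tau ->
  generator_graph X T (wint a b tau u)
    (minus (minus (scal (a + b * tau) (T tau u)) (scal a u)) (scal b (wint 1 0 tau u))).
Proof.
  intros Ht.
  set (F s := scal (a + b * s) (T (Rmax 0 s) u)).
  set (G s := scal (1 + 0 * s) (T (Rmax 0 s) u)).
  assert (HF : forall t, continuous F t) by apply wint_integrand_cont.
  assert (HG : forall t, continuous G t) by apply wint_integrand_cont.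
  (* [T h] shifts the orbit to s + h, while a + b s = (a + b (s + h)) - b h; the correction is an
     integral of [G], the orbit with weight 1. *)
  assert (E : forall h, 0 < h -> T h (RInt F 0 tau) =
    minus (minus (RInt F 0 (tau + h)) (RInt F 0 (0 + h)))
      (scal (b * h) (minus (RInt G 0 (tau + h)) (RInt G 0 (0 + h))))).
  { intros h Hh.
    apply (is_RInt_functional _ _ _ _ _ (is_RInt_linear (T h) F 0 tau _
      (sg_lin h ltac:(lra)) (continuous_RInt_exists F 0 tau HF))).
    apply is_RInt_ext with (fun s => minus (F (s + h)) (scal (b * h) (G (s + h)))).
    - rewrite Rmin_left, Rmax_right by trivial. intros s Hs. unfold F, G.
      rewrite (linear_scal (T h)) by (apply sg_lin; lra).
      rewrite !Rmax_right, (Rplus_comm s h), sg_add by lra. vec.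
    - apply (is_RInt_minus' (fun s => F (s + h)) (fun s => scal (b * h) (G (s + h)))).
      + now apply is_RInt_shift, is_RInt_difference.
      + apply (is_RInt_scal' (b * h) (fun s => G (s + h))).
        now apply is_RInt_shift, is_RInt_difference. }
  assert (DF : forall t, rderiv (fun s => RInt F 0 s) t (F t)) by (intros; now apply rderiv_RInt).
  assert (LG : forall t, filterlim (fun h => RInt G 0 (t + h)) (at_right 0) (locally (RInt G 0 t))).
  { intros t. refine (filterlim_comp _ _ _ _ _ _ _ _ (at_right_shift t) _).
    now apply continuous_RInt_upper. }
  unfold generator_graph, wint. fold F G.
  apply filterlim_ext_loc with (fun h =>
    minus (minus (scal (/ h) (minus (RInt F 0 (tau + h)) (RInt F 0 tau)))
                 (scal (/ h) (minus (RInt F 0 (0 + h)) (RInt F 0 0))))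
      (scal b (minus (RInt G 0 (tau + h)) (RInt G 0 (0 + h))))).
  - generalize at_right_0_pos. apply filter_imp. intros h Hh.
    rewrite E, (RInt_point 0 F) by trivial. vec.
  - replace (scal (a + b * tau) (T tau u)) with (F tau) by (unfold F; now rewrite Rmax_right).
    replace (scal a u) with (F 0).
    2:{ unfold F. rewrite Rmax_left, sg_id by lra. vec. }
    replace (RInt G 0 tau) with (minus (RInt G 0 tau) (RInt G 0 0))
      by (rewrite RInt_point; vec).
    apply lim_minus; [apply lim_minus; apply DF|]. apply lim_scal, lim_minus; apply LG.
Qed.

Lemma wint_1_norm tau u : 0 <= tau -> pos u -> norm (wint 1 0 tau u) <= tau * norm u.
Proof.
  intros Ht Hu. replace (tau * norm u) with ((tau - 0) * norm u) by ring.
  apply norm_RInt_le_const with (3 := wint_correct 1 0 tau u); trivial.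
  intros s Hs. vreplace (scal (1 + 0 * s) (T (Rmax 0 s) u)) with (T (Rmax 0 s) u).
  apply HT; trivial. apply Rmax_l.
Qed.

Lemma wint_1_generator tau u v : 0 <= tau -> generator_graph X T u v ->
  wint 1 0 tau v = minus (T tau u) u.
Proof.
  intros Ht H. apply is_RInt_unique.
  assert (K : is_RInt (fun s => T (Rmax 0 s) v) 0 tau
    (minus (T (Rmax 0 tau) u) (T (Rmax 0 0) u))).
  { apply (is_RInt_rderiv (fun s => T (Rmax 0 s) u)); trivial; try apply orbit_cont.
    intros t Ht'. rewrite (Rmax_right 0 t) by lra. apply rderiv_orbit; trivial; lra. }
  rewrite Rmax_right, Rmax_left, sg_id in K by lra.
  apply is_RInt_ext with (2 := K). intros s _. vec.
Qed.

(* Integration by parts in [wint 1 (-1) 1 v]. *)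
Lemma generator_graph_representation u v : generator_graph X T u v ->
  u = minus (wint 1 0 1 u) (wint 1 (-1) 1 v).
Proof.
  intros H.
  assert (K : is_RInt (fun s => plus (scal (1 + -1 * s) (T (Rmax 0 s) v))
      (scal (-1) (T (Rmax 0 s) u))) 0 1
    (minus (scal (1 + -1 * 1) (T (Rmax 0 1) u)) (scal (1 + -1 * 0) (T (Rmax 0 0) u)))).
  { apply (is_RInt_rderiv (fun s => scal (1 + -1 * s) (T (Rmax 0 s) u))); [lra| | |].
    - apply wint_integrand_cont.
    - intros t. apply lim_plus; [apply wint_integrand_cont|]. apply lim_scal, orbit_cont.
    - intros t Ht. apply (rderiv_affine (fun s => T (Rmax 0 s) u)); [apply orbit_cont|].
      rewrite (Rmax_right 0 t) by lra. apply rderiv_orbit; trivial; lra. }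
  rewrite (Rmax_left 0 0), sg_id in K by lra.
  assert (K' : is_RInt (fun s => plus (scal (1 + -1 * s) (T (Rmax 0 s) v))
      (scal (-1) (T (Rmax 0 s) u))) 0 1 (minus (wint 1 (-1) 1 v) (wint 1 0 1 u))).
  { apply is_RInt_ext with (2 := is_RInt_minus' _ _ _ _ _ _
      (wint_correct 1 (-1) 1 v) (wint_correct 1 0 1 u)). intros s _. vec. }
  assert (E := is_RInt_functional _ _ _ _ _ K K').
  vreplace (minus (wint 1 0 1 u) (wint 1 (-1) 1 v)) with
    (opp (minus (wint 1 (-1) 1 v) (wint 1 0 1 u))).
  rewrite <- E. vec.
Qed.

(** The mean of the orbit over [0, h]. These means lie in the domain, preserve the cone, commute
    with the generator on its domain and converge to u, so the positive part of the domain is dense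
    in the cone. *)
Definition avg (h : R) (u : X) : X := scal (/ h) (wint 1 0 h u).

Lemma avg_minus h u v : avg h (minus u v) = minus (avg h u) (avg h v).
Proof. unfold avg. rewrite wint_minus. vec. Qed.

Lemma avg_pos h u : 0 < h -> pos u -> pos (avg h u).
Proof.
  intros Hh Hu. apply (pos_scal _ _ HX); [left; now apply Rinv_0_lt_compat|].
  apply wint_pos; trivial; intros; lra.
Qed.

Lemma avg_contr h u : 0 < h -> pos u -> norm (avg h u) <= norm u.
Proof.
  intros Hh Hu. apply Rle_trans with (1 := norm_scal_le _ _).
  assert (0 < / h) by now apply Rinv_0_lt_compat.
  rewrite Rabs_pos_eq by lra.
  apply Rle_trans with (/ h * (h * norm u)).
  - apply Rmult_le_compat_l; [lra|]. apply wint_1_norm; trivial; lra.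
  - rewrite <- Rmult_assoc, Rinv_l by lra. lra.
Qed.

Lemma avg_lim u : filterlim (fun h => avg h u) (at_right 0) (locally u).
Proof.
  assert (K := rderiv_RInt (fun s => scal (1 + 0 * s) (T (Rmax 0 s) u)) 0 0
    (wint_integrand_cont 1 0 u)).
  unfold rderiv in K. rewrite Rmax_left, sg_id in K by lra.
  replace (scal (1 + 0 * 0) u) with u in K by vec.
  apply filterlim_ext with (2 := K). intros h.
  rewrite RInt_point, Rplus_0_l. unfold avg, wint. vec.
Qed.

Lemma avg_generator h u v : 0 < h -> generator_graph X T u v ->
  generator_graph X T (avg h u) (avg h v).
Proof.
  intros Hh H. unfold avg at 2. rewrite (wint_1_generator h u v) by (trivial; lra).
  apply generator_graph_scal.
  vreplace (minus (T h u) u) with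
    (minus (minus (scal (1 + 0 * h) (T h u)) (scal 1 u)) (scal 0 (wint 1 0 h u))).
  apply generator_graph_wint. lra.
Qed.

End Semigroup.
(** * The perturbation and the Duhamel operator *)

Section Perturbation.
Variable U : R -> X -> X.
Hypothesis HU : is_substochastic_C0_semigroup X pos U.
Variables (D : X -> Prop) (A : X -> X).
Hypothesis HA : is_generator X U D A.

(** * The domain of the generator *)

Lemma dom_graph u v : generator_graph X U u v -> D u /\ A u = v.
Proof.
  intros H. assert (Du : D u) by (apply HA; now exists v).
  split; trivial. apply (generator_graph_unique U u); trivial. now apply HA.
Qed.

Lemma dom_plus u v : D u -> D v -> D (plus u v).
Proof.
  intros Hu Hv. eapply dom_graph, (generator_graph_plus U HU); now apply HA.
Qed.

Lemma dom_scal c u : D u -> D (scal c u).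
Proof. intros Hu. eapply dom_graph, (generator_graph_scal U HU); now apply HA. Qed.

Lemma dom_minus u v : D u -> D v -> D (minus u v).
Proof.
  intros Hu Hv. vreplace (minus u v) with (plus u (scal (-1) v)).
  apply dom_plus; trivial. now apply dom_scal.
Qed.

Lemma dom_A_minus u v : D u -> D v -> A (minus u v) = minus (A u) (A v).
Proof.
  intros Hu Hv. vreplace (minus u v) with (plus u (scal (-1) v)).
  replace (minus (A u) (A v)) with (plus (A u) (scal (-1) (A v))) by vec.
  apply dom_graph, (generator_graph_plus U HU); [now apply HA|].
  apply (generator_graph_scal U HU). now apply HA.
Qed.

Lemma dom_orbit u t : 0 <= t -> D u -> D (U t u) /\ A (U t u) = U t (A u).
Proof. intros Ht Hu. apply dom_graph, (generator_graph_orbit U HU); trivial. now apply HA. Qed.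

Lemma dom_wint a b tau u : 0 <= tau -> D (wint U a b tau u).
Proof. intros Ht. eapply dom_graph, (generator_graph_wint U HU); trivial. Qed.

Lemma dom_avg h u : 0 < h -> D (avg U h u).
Proof. intros Hh. apply dom_scal, dom_wint. lra. Qed.

Lemma dom_avg_comm h u : 0 < h -> D u -> A (avg U h u) = avg U h (A u).
Proof.
  intros Hh Hu. apply dom_graph, (avg_generator U HU); trivial. now apply HA.
Qed.

Lemma dom_representation u : D u ->
  u = minus (wint U 1 0 1 u) (wint U 1 (-1) 1 (A u)).
Proof. intros Hu. apply (generator_graph_representation U HU). now apply HA. Qed.

(** A decomposition of u in X may leave [D]. Inserting decompositions of u and of [A u] into the two
    integrals of [dom_representation] yields four positive elements of [D], grouped by sign. *)
Lemma dom_generating u : D u ->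
  exists v w, D v /\ D w /\ pos v /\ pos w /\ u = minus v w.
Proof.
  intros Hu.
  destruct (Hdec u) as [v [w [Hv [Hw [E _]]]]].
  destruct (Hdec (A u)) as [v' [w' [Hv' [Hw' [E' _]]]]].
  exists (plus (wint U 1 0 1 v) (wint U 1 (-1) 1 w')),
    (plus (wint U 1 0 1 w) (wint U 1 (-1) 1 v')).
  assert (D01 : forall u, D (wint U 1 0 1 u)) by (intros; apply dom_wint; lra).
  assert (D11 : forall u, D (wint U 1 (-1) 1 u)) by (intros; apply dom_wint; lra).
  assert (P01 : forall u, pos u -> pos (wint U 1 0 1 u)).
  { intros; apply (wint_pos U HU); trivial; intros; lra. }
  assert (P11 : forall u, pos u -> pos (wint U 1 (-1) 1 u)).
  { intros; apply (wint_pos U HU); trivial; intros; lra. }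
  split; [now apply dom_plus|]. split; [now apply dom_plus|].
  split; [apply (pos_plus _ _ HX); auto|]. split; [apply (pos_plus _ _ HX); auto|].
  rewrite (dom_representation u Hu), E' at 1. rewrite E at 1.
  rewrite !(wint_minus U HU). vec.
Qed.

(** * Passage from the domain to the whole space *)

Lemma dom_linear_eq (L L' : X -> X) : is_linear L -> is_linear L' ->
  (forall u, D u -> L u = L' u) -> forall u, L u = L' u.
Proof.
  intros HL HL' H u.
  apply (lim_unique (F := at_right 0) (fun h => L (avg U h u))).
  - apply lim_linear; trivial. apply (avg_lim U HU).
  - apply filterlim_ext_loc with (fun h => L' (avg U h u)).
    + generalize at_right_0_pos. apply filter_imp. intros h Hh.
      symmetry. now apply H, dom_avg.
    + apply lim_linear; trivial. apply (avg_lim U HU).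
Qed.

(** The approximants must be positive as well as in [D]; means of a positive orbit are both. *)
Lemma dom_linear_pos (L : X -> X) : is_linear L ->
  (forall u, D u -> pos u -> pos (L u)) -> forall u, pos u -> pos (L u).
Proof.
  intros HL H u Hu.
  apply (pos_lim HX (F := at_right 0) (fun h => L (avg U h u))).
  - apply lim_linear; trivial. apply (avg_lim U HU).
  - generalize at_right_0_pos. apply filter_imp. intros h Hh.
    apply H; [now apply dom_avg|]. now apply (avg_pos U HU).
Qed.

(** The bound by [norm u] is given on positive elements of [D] only, and no norm-controlled
    splitting inside [D] is at hand. Averaging avoids this: u is split in X, and E0 (avg h u) is
    bounded by M * norm u uniformly in h. For u in [D] the graph-norm bound lets h tend to 0, so the
    same [M] bounds [E0] on [D]; the extension is the limit of E0 (avg h u). *)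
Lemma dom_extension (E0 : X -> X) C : 0 <= C ->
  (forall u v, D u -> D v -> E0 (plus u v) = plus (E0 u) (E0 v)) ->
  (forall c u, D u -> E0 (scal c u) = scal c (E0 u)) ->
  (forall u, D u -> pos u -> norm (E0 u) <= norm u) ->
  (forall u, D u -> norm (E0 u) <= C * (norm u + norm (A u))) ->
  exists E, is_linear E /\ forall u, D u -> E u = E0 u.
Proof.
  intros HC Hp Hs H1 H2.
  assert (Hm : forall u v, D u -> D v -> E0 (minus u v) = minus (E0 u) (E0 v)).
  { intros u v Hu Hv. vreplace (minus u v) with (plus u (scal (-1) v)).
    rewrite Hp, Hs by (trivial; now apply dom_scal). vec. }
  assert (AL := avg_lim U HU).
  assert (B1 : forall h u, 0 < h -> norm (E0 (avg U h u)) <= M * norm u).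
  { intros h u Hh. rewrite <- (Rmult_1_l M).
    apply (cone_bound (fun u => E0 (avg U h u))); [lra| |].
    - intros v w. rewrite (avg_minus U HU), Hm by now apply dom_avg. trivial.
    - intros v Hv. rewrite Rmult_1_l.
      apply Rle_trans with (norm (avg U h v)).
      + apply H1; [now apply dom_avg|]. now apply (avg_pos U HU).
      + now apply (avg_contr U HU). }
  assert (B2 : forall u, D u -> filterlim (fun h => E0 (avg U h u)) (at_right 0) (locally (E0 u))).
  { intros u Hu. apply lim_zero_le with
      (g := fun h => C * (norm (minus (avg U h u) u) + norm (minus (avg U h (A u)) (A u)))).
    - generalize at_right_0_pos. apply filter_imp. intros h Hh.
      rewrite <- Hm by (trivial; now apply dom_avg).
      rewrite <- dom_avg_comm, <- dom_A_minus by (trivial; now apply dom_avg).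
      apply H2, dom_minus; trivial. now apply dom_avg.
    - apply limR_zero_scal, limR_zero_plus; apply lim_norm_zero, AL. }
  assert (B3 : forall u, D u -> norm (E0 u) <= M * norm u).
  { intros u Hu. apply (lim_norm_le (F := at_right 0) _ _ _ (B2 u Hu)).
    generalize at_right_0_pos. apply filter_imp. intros h Hh. now apply B1. }
  assert (B4 : forall u, exists l, filterlim (fun h => E0 (avg U h u)) (at_right 0) (locally l)).
  { intros u.
    refine (proj1 (filterlim_locally_cauchy (U := CompleteNormedModule.CompleteSpace _ X)
      (F := at_right 0) (fun h => E0 (avg U h u))) _). intros eps.
    set (d := eps / (2 * M)).
    assert (Hd : 0 < d) by (apply Rdiv_lt_0_compat; [apply cond_pos|lra]).
    exists (fun h => 0 < h /\ norm (minus (avg U h u) u) < d). split.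
    - apply filter_and; [apply at_right_0_pos|].
      exact (proj1 (lim_norm_iff _ u) (AL u) d Hd).
    - intros h k [Hh Lh] [Hk Lk]. apply (norm_compat1 (V := X)).
      change (norm (minus (E0 (avg U k u)) (E0 (avg U h u))) < eps).
      rewrite <- Hm by now apply dom_avg.
      apply Rle_lt_trans with (M * norm (minus (avg U k u) (avg U h u))).
      + apply B3, dom_minus; now apply dom_avg.
      + assert (K := norm_minus_trans (avg U k u) u (avg U h u)).
        rewrite (norm_minus_sym u) in K.
        apply Rlt_le_trans with (M * (2 * d)).
        * apply Rmult_lt_compat_l; lra.
        * right. unfold d. field. lra. }
  destruct (choice _ B4) as [E HE]. exists E. split.
  - split.
    + intros u v.
      apply (lim_unique (F := at_right 0) (fun h => E0 (avg U h (plus u v)))); [apply HE|].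
      refine (filterlim_ext_loc _ _ _ (lim_plus _ _ _ _ (HE u) (HE v))).
      generalize at_right_0_pos. apply filter_imp. intros h Hh.
      rewrite <- Hp by now apply dom_avg. f_equal.
      (* Additivity of [avg] is drawn from [avg_minus], with zero written as [minus u u]. *)
      vreplace (plus u v) with (minus u (minus (minus u u) v)).
      rewrite !(avg_minus U HU). vec.
    + intros c u.
      apply (lim_unique (F := at_right 0) (fun h => E0 (avg U h (scal c u)))); [apply HE|].
      refine (filterlim_ext_loc _ _ _ (lim_scal c _ _ (HE u))).
      generalize at_right_0_pos. apply filter_imp. intros h Hh.
      rewrite <- Hs by now apply dom_avg. f_equal. unfold avg.
      rewrite (wint_scal U HU). vec.
    + exists M. split; trivial. intros u.
      apply (lim_norm_le (F := at_right 0) _ _ _ (HE u)).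
      generalize at_right_0_pos. apply filter_imp. intros h Hh. now apply B1.
  - intros u Hu. apply (lim_unique (F := at_right 0) _ _ _ (HE u)). now apply B2.
Qed.

(** * The perturbation is bounded for the graph norm *)

Variable Psi : X -> R.
Hypothesis HPsi : is_norm_functional X pos Psi.
Variable B : X -> X.
Hypothesis HB : is_positive_linear_on X pos D B.
Hypothesis HAB : forall u : X, D u -> pos u -> Psi (plus (A u) (B u)) <= 0.

Lemma psi_minus u v : Psi (minus u v) = Psi u - Psi v.
Proof. exact (clinear_minus (W := R_CompleteNormedModule) Psi u v (proj1 HPsi)). Qed.

Lemma B_minus u v : D u -> D v -> B (minus u v) = minus (B u) (B v).
Proof.
  intros Hu Hv. vreplace (minus u v) with (plus u (scal (-1) v)).
  rewrite (on_plus _ _ _ _ HB), (on_scal _ _ _ _ HB) by (trivial; now apply dom_scal). vec.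
Qed.

(** [B u] is positive, so its norm is a value of [Psi], and dissipativity compares it with [A u]. *)
Lemma B_norm_le u : D u -> pos u -> norm (B u) <= - Psi (A u).
Proof.
  intros Hu Pu. assert (K := HAB u Hu Pu).
  rewrite (linear_plus Psi (proj1 HPsi)) in K. change plus with Rplus in K.
  rewrite <- (proj2 HPsi) by now apply HB. lra.
Qed.

(** For positive v, [A] maps the first integral to U(1) v - v and the second to the integral of U(s)
    v over [0, 1] minus v. In both cases - [Psi] is at most norm v. *)
Lemma B_wint_bound u : norm (B (wint U 1 0 1 u)) <= 1 * M * norm u /\
  norm (B (wint U 1 (-1) 1 u)) <= 1 * M * norm u.
Proof.
  assert (G := fun b u => dom_graph _ _ (generator_graph_wint U HU 1 b 1 u Rle_0_1)).
  assert (P : forall b u, -1 <= b -> pos u -> pos (wint U 1 b 1 u)).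
  { intros b v Hb Hv. apply (wint_pos U HU); trivial; [lra|]. intros s Hs.
    generalize (Rmult_le_compat_r s (-1) b); lra. }
  split.
  - apply (cone_bound (fun u => B (wint U 1 0 1 u))); [lra| |].
    + intros v w. rewrite (wint_minus U HU). apply B_minus; apply G.
    + intros v Hv. apply Rle_trans with (1 := B_norm_le _ (proj1 (G 0 v)) (P 0 v ltac:(lra) Hv)).
      rewrite (proj2 (G 0 v)).
      vreplace (minus (minus (scal (1 + 0 * 1) (U 1 v)) (scal 1 v)) (scal 0 (wint U 1 0 1 v)))
        with (minus (U 1 v) v).
      rewrite psi_minus, !(proj2 HPsi) by (trivial; apply HU; trivial; lra).
      generalize (norm_ge_0 (U 1 v)). lra.
  - apply (cone_bound (fun u => B (wint U 1 (-1) 1 u))); [lra| |].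
    + intros v w. rewrite (wint_minus U HU). apply B_minus; apply G.
    + intros v Hv.
      apply Rle_trans with (1 := B_norm_le _ (proj1 (G (-1) v)) (P (-1) v ltac:(lra) Hv)).
      rewrite (proj2 (G (-1) v)).
      vreplace (minus (minus (scal (1 + -1 * 1) (U 1 v)) (scal 1 v)) (scal (-1) (wint U 1 0 1 v)))
        with (minus (wint U 1 0 1 v) v).
      rewrite psi_minus, !(proj2 HPsi) by (trivial; apply P; trivial; lra).
      generalize (norm_ge_0 (wint U 1 0 1 v)). lra.
Qed.

Lemma B_bound u : D u -> norm (B u) <= M * (norm u + norm (A u)).
Proof.
  intros Hu. rewrite (dom_representation u Hu) at 1.
  rewrite B_minus by (apply dom_wint; lra).
  generalize (norm_minus_le (B (wint U 1 0 1 u)) (B (wint U 1 (-1) 1 (A u))))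
    (proj1 (B_wint_bound u)) (proj2 (B_wint_bound (A u))). lra.
Qed.

Lemma B_orbit_bound u s : 0 <= s -> D u ->
  norm (B (U s u)) <= M * M * (norm u + norm (A u)).
Proof.
  intros Hs Hu. destruct (dom_orbit u s Hs Hu) as [H1 H2].
  apply Rle_trans with (1 := B_bound _ H1). rewrite H2, Rmult_assoc.
  apply Rmult_le_compat_l; [lra|].
  generalize (sg_norm U HU s u Hs) (sg_norm U HU s (A u) Hs). lra.
Qed.

(** Since A U(s) u = U(s) A u, orbits starting in [D] are continuous for the graph norm, for which
    [B] is bounded. *)
Lemma B_orbit_cont u t : D u -> continuous (fun s => B (U (Rmax 0 s) u)) t.
Proof.
  intros Hu. apply lim_zero_le with (g := fun s => M *
    (norm (minus (U (Rmax 0 s) u) (U (Rmax 0 t) u)) +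
     norm (minus (U (Rmax 0 s) (A u)) (U (Rmax 0 t) (A u))))).
  - apply filter_forall. intros s.
    destruct (dom_orbit u _ (Rmax_l 0 s) Hu) as [H1 H2].
    destruct (dom_orbit u _ (Rmax_l 0 t) Hu) as [H3 H4].
    rewrite <- B_minus, <- H2, <- H4, <- dom_A_minus by trivial.
    now apply B_bound, dom_minus.
  - apply limR_zero_scal, limR_zero_plus;
      apply lim_norm_zero, (orbit_cont U HU).
Qed.

(** The integral defining L(S)(t) u for u in [D]; clamping both times at 0 makes the integrand
    continuous on all of R when S is tame. *)
Definition duhamel (S : R -> X -> X) (t : R) (u : X) : X :=
  RInt (fun s => S (Rmax 0 (t - s)) (B (U (Rmax 0 s) u))) 0 t.

Lemma duhamel_cont S t u s : tame S -> D u ->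
  continuous (fun s => S (Rmax 0 (t - s)) (B (U (Rmax 0 s) u))) s.
Proof.
  intros HS Hu. apply (tame_conv_continuous S (fun s => B (U (Rmax 0 s) u))); trivial.
  intros; now apply B_orbit_cont.
Qed.

Lemma duhamel_correct S t u : tame S -> D u ->
  is_RInt (fun s => S (Rmax 0 (t - s)) (B (U (Rmax 0 s) u))) 0 t (duhamel S t u).
Proof. intros HS Hu. apply continuous_RInt_exists. intros; now apply duhamel_cont. Qed.

Lemma duhamel_is_RInt S t u l : 0 <= t -> tame S -> D u ->
  is_RInt (fun s => S (t - s) (B (U s u))) 0 t l <-> l = duhamel S t u.
Proof.
  intros Ht HS Hu.
  assert (K : is_RInt (fun s => S (t - s) (B (U s u))) 0 t (duhamel S t u)).
  { apply is_RInt_ext with (2 := duhamel_correct S t u HS Hu).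
    rewrite Rmin_left, Rmax_right by trivial. intros s Hs.
    now rewrite !Rmax_right by lra. }
  split; [|now intros ->]. intros Hl. apply (is_RInt_functional _ _ _ _ _ Hl K).
Qed.

Lemma B_orbit_pos u s : D u -> pos u -> pos (B (U (Rmax 0 s) u)).
Proof.
  intros Hu Pu. apply HB.
  - apply dom_orbit; trivial. apply Rmax_l.
  - apply HU; trivial. apply Rmax_l.
Qed.

Lemma duhamel_pos S t u : tame S -> 0 <= t -> D u -> pos u -> pos (duhamel S t u).
Proof.
  intros HS Ht Hu Pu. apply (pos_RInt HX _ 0 t _ Ht) with (2 := duhamel_correct S t u HS Hu).
  intros s. apply (tame_pos S HS); [apply Rmax_l|]. now apply B_orbit_pos.
Qed.

Lemma duhamel_mono S S' t u : tame S -> tame S' ->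
  (forall s v, 0 <= s -> pos v -> pos (minus (S' s v) (S s v))) ->
  0 <= t -> D u -> pos u -> pos (minus (duhamel S' t u) (duhamel S t u)).
Proof.
  intros HS HS' H Ht Hu Pu.
  apply (pos_RInt HX _ 0 t _ Ht) with (2 := is_RInt_minus' _ _ _ _ _ _
    (duhamel_correct S' t u HS' Hu) (duhamel_correct S t u HS Hu)).
  intros s. apply H; [apply Rmax_l|]. now apply B_orbit_pos.
Qed.

Lemma duhamel_extension S t : 0 <= t -> tame S ->
  (forall u, D u -> pos u -> norm (duhamel S t u) <= norm u) ->
  exists E, is_Duhamel_extension X D B U S t E.
Proof.
  intros Ht HS H.
  assert (L : forall s, is_linear (S (Rmax 0 s))) by (intros; apply HS, Rmax_l).
  assert (LU : forall s, is_linear (U (Rmax 0 s))) by (intros; apply (sg_lin U HU), Rmax_l).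
  assert (DU : forall s u, D u -> D (U (Rmax 0 s) u)).
  { intros s u Hu. apply dom_orbit; trivial. apply Rmax_l. }
  (* The length t of the interval, a factor M for S, and M * M for [B] along an orbit
     ([B_orbit_bound]). *)
  destruct (dom_extension (duhamel S t) (t * (M * (M * M)))) as [E [H1 H2]].
  - repeat apply Rmult_le_pos; lra.
  - intros u v Hu Hv. apply is_RInt_unique.
    apply is_RInt_ext with (2 := is_RInt_plus' _ _ _ _ _ _
      (duhamel_correct S t u HS Hu) (duhamel_correct S t v HS Hv)).
    intros s _. rewrite (linear_plus _ (LU s)), (on_plus _ _ _ _ HB) by auto.
    now rewrite (linear_plus _ (L _)).
  - intros c u Hu. apply is_RInt_unique.
    apply is_RInt_ext with (2 := is_RInt_scal' c _ _ _ _ (duhamel_correct S t u HS Hu)).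
    intros s _. rewrite (linear_scal _ (LU s)), (on_scal _ _ _ _ HB) by auto.
    now rewrite (linear_scal _ (L _)).
  - trivial.
  - intros u Hu. replace (t * (M * (M * M)) * (norm u + norm (A u))) with
      ((t - 0) * (M * (M * M * (norm u + norm (A u))))) by ring.
    apply norm_RInt_le_const with (3 := duhamel_correct S t u HS Hu); trivial.
    intros s Hs. apply Rle_trans with (1 := tame_bound S _ _ HS (Rmax_l _ _)).
    apply Rmult_le_compat_l; [lra|]. apply B_orbit_bound; trivial. apply Rmax_l.
  - exists E. split; trivial. intros u Hu. now apply duhamel_is_RInt; [| | |apply H2].
Qed.

(** * The Dyson-Phillips terms *)

Variable V : R -> X -> X.
Hypothesis HV : is_substochastic_C0_semigroup X pos V.
Hypothesis HVG : generator_extends X V D (fun u => plus (A u) (B u)).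

Lemma V_tame : tame V.
Proof. now apply semigroup_tame. Qed.

Lemma V_duhamel t u : 0 <= t -> D u -> V t u = plus (U t u) (duhamel V t u).
Proof.
  intros Ht Hu.
  set (f s := V (Rmax 0 (t - s)) (U (Rmax 0 s) u)).
  set (g s := scal (-1) (V (Rmax 0 (t - s)) (B (U (Rmax 0 s) u)))).
  assert (K : is_RInt g 0 t (minus (f t) (f 0))).
  { apply is_RInt_rderiv; trivial.
    - apply tame_conv_continuous; [apply V_tame|]. intros; now apply orbit_cont.
    - intros s. apply lim_scal. now apply duhamel_cont; [apply V_tame|].
    - intros s Hs. destruct (dom_orbit u s ltac:(lra) Hu) as [Dw Ew].
      set (w := U s u) in *.
      assert (Q1 := rderiv_orbit U HU u (A u) s ltac:(lra) (proj2 HA u Hu)).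
      assert (Q2 := HVG w Dw). cbv beta in Q2. rewrite Ew in Q2.
      assert (Q := lim_minus _ _ _ _ Q1 Q2). cbv beta in Q.
      replace (g s) with (V (Rmax 0 (t - s)) (minus (U s (A u)) (plus (U s (A u)) (B w)))).
      2:{ unfold g. rewrite (Rmax_right 0 s) by lra. fold w.
          rewrite <- (linear_scal (V _)) by apply (sg_lin V HV), Rmax_l. f_equal. vec. }
      (* For h < t - s, V(t-s) = V(t-(s+h)) V(h) lets V(t-(s+h)) be factored out of both increments:
         uniformly bounded operators are applied to a convergent difference of quotients. *)
      apply filterlim_ext_loc with (fun h => V (Rmax 0 (t - (s + h)))
        (minus (scal (/ h) (minus (U (Rmax 0 (s + h)) u) (U (Rmax 0 s) u)))
               (scal (/ h) (minus (V h w) w)))).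
      + apply at_right_0_iff. exists (t - s). split; [lra|]. intros h Hh.
        unfold f. rewrite (Rmax_right 0 s), (Rmax_right 0 (s + h)), (Rmax_right 0 (t - s)),
          (Rmax_right 0 (t - (s + h))) by lra. fold w.
        replace (t - s) with (t - (s + h) + h) by ring.
        rewrite (sg_add V HV) by lra.
        assert (LV := sg_lin V HV (t - (s + h)) ltac:(lra)).
        rewrite <- (clinear_minus _ _ _ LV), <- (linear_scal _ LV). f_equal. vec.
      + apply (lim_equicontinuous (fun h => V (Rmax 0 (t - (s + h)))) _ _ _ M) with (3 := Q).
        * apply filter_forall. intros h v v'. symmetry. apply clinear_minus, (sg_lin V HV), Rmax_l.
        * apply filter_forall. intros h v. apply sg_norm; trivial. apply Rmax_l.
        * assert (C : filterlim (fun h => t - (s + h)) (at_right 0) (locally (t - s))).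
          { assert (C : continuous (fun r => t - r) s).
            { apply (continuous_minus (V := R_NormedModule) (fun _ => t) (fun r => r)).
              - apply continuous_const.
              - apply continuous_id. }
            exact (filterlim_comp _ _ _ _ _ _ _ _ (at_right_shift s) C). }
          exact (filterlim_comp _ _ _ _ _ _ _ _ C (tame_cont V V_tame _ (t - s))). }
  assert (K' : is_RInt g 0 t (scal (-1) (duhamel V t u))).
  { apply is_RInt_scal', duhamel_correct; [apply V_tame|trivial]. }
  assert (E := is_RInt_functional _ _ _ _ _ K K').
  unfold f in E. rewrite Rminus_diag, Rminus_0_r, (Rmax_right 0 t), (Rmax_left 0 0) in E by lra.
  rewrite (sg_id V HV), (sg_id U HU) in E.
  replace (duhamel V t u) with (scal (-1) (scal (-1) (duhamel V t u))) by vec.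
  rewrite <- E. vec.
Qed.

Local Notation dp := (DP_term X D B U).

Definition dp_sum (n : nat) (t : R) (u : X) : X := sum_n (fun k => dp k t u) n.

(** The induction hypothesis. Domination by V makes the next term exist, tameness allows it to be
    integrated, and the addition formula gives the strong continuity contained in tameness at the
    next index. *)
Record dp_good (n : nat) : Prop := {
  dp_tame : tame (dp n);
  dp_add : forall t s u, 0 <= t -> 0 <= s ->
    dp n (t + s) u = sum_n (fun j => dp j t (dp (n - j) s u)) n;
  dp_dominated : forall t u, 0 <= t -> pos u -> pos (minus (V t u) (dp_sum n t u))
}.

Lemma dp_le_V n t u : (forall k, (k <= n)%nat -> dp_good k) -> 0 <= t -> pos u ->
  pos (minus (V t u) (dp n t u)).
Proof.
  intros H Ht Hu. apply (pos_minus_trans HX _ (dp_sum n t u)).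
  - unfold dp_sum. apply (pos_sum_minus_term HX (fun k => dp k t u)); [|lia].
    intros k Hk. now apply (tame_pos _ (dp_tame k (H k Hk))).
  - apply (dp_dominated n (H n (le_n n))); trivial.
Qed.

Lemma dp_sum_pos n t u : (forall k, (k <= n)%nat -> dp_good k) -> 0 <= t -> pos u ->
  pos (dp_sum n t u).
Proof.
  intros H Ht Hu. apply (pos_sum HX). intros k Hk.
  now apply (tame_pos _ (dp_tame k (H k Hk))).
Qed.

Lemma dp_sum_tame n : (forall k, (k <= n)%nat -> dp_good k) -> tame (dp_sum n).
Proof.
  intros H. split.
  - intros t Ht. apply (clinear_sum_n (fun k => dp k t)). intros k Hk.
    now apply (tame_linear _ (dp_tame k (H k Hk))).
  - intros t u Ht Hu. now apply dp_sum_pos.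
  - intros t u Ht Hu. apply Rle_trans with (norm (V t u)).
    + apply (pos_norm_mono HX); [now apply dp_sum_pos|].
      apply (dp_dominated n (H n (le_n n))); trivial.
    + now apply HV.
  - intros u t. apply (lim_sum_n (fun k s => dp k (Rmax 0 s) u)). intros k Hk.
    apply (tame_cont _ (dp_tame k (H k Hk))).
Qed.

Lemma duhamel_dp_sum n t u : (forall k, (k <= n)%nat -> dp_good k) -> D u ->
  duhamel (dp_sum n) t u = sum_n (fun k => duhamel (dp k) t u) n.
Proof.
  intros H Hu. apply is_RInt_unique.
  apply (is_RInt_sum_n (fun k s => dp k (Rmax 0 (t - s)) (B (U (Rmax 0 s) u)))).
  intros k Hk. apply duhamel_correct; trivial. apply dp_tame. now apply H.
Qed.

(** For positive u in [D], the Duhamel integral of [dp n] lies below that of V, hence below V(t) u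
    by the Duhamel formula. Contractivity of V then gives the bound that [duhamel_extension] asks
    for. *)
Lemma dp_extension n t : (forall k, (k <= n)%nat -> dp_good k) -> 0 <= t ->
  is_Duhamel_extension X D B U (dp n) t (dp (S n) t).
Proof.
  intros H Ht. assert (Hn := dp_tame n (H n (le_n n))).
  change (dp (S n) t) with (epsilon (inhabits (fun u : X => u))
    (is_Duhamel_extension X D B U (dp n) t)).
  apply epsilon_spec, duhamel_extension; trivial.
  intros u Hu Pu. apply Rle_trans with (norm (V t u)); [|now apply HV].
  apply (pos_norm_mono HX); [now apply duhamel_pos|].
  rewrite V_duhamel by trivial.
  vreplace (minus (plus (U t u) (duhamel V t u)) (duhamel (dp n) t u)) with
    (plus (U t u) (minus (duhamel V t u) (duhamel (dp n) t u))).
  apply (pos_plus _ _ HX); [now apply HU|].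
  apply duhamel_mono; trivial; [apply V_tame|].
  intros s v Hs Hv. now apply dp_le_V.
Qed.

Lemma dp_duhamel n t u : (forall k, (k <= n)%nat -> dp_good k) -> 0 <= t -> D u ->
  dp (S n) t u = duhamel (dp n) t u.
Proof.
  intros H Ht Hu. apply duhamel_is_RInt; trivial; [now apply dp_tame, H|].
  now apply (dp_extension n t H Ht).
Qed.

(** The partial sums are the Picard iterates of the equation W = U + L(W), which V solves. *)
Lemma dp_sum_duhamel n t u : (forall k, (k <= n)%nat -> dp_good k) -> 0 <= t -> D u ->
  dp_sum (S n) t u = plus (U t u) (duhamel (dp_sum n) t u).
Proof.
  intros H Ht Hu. unfold dp_sum at 1. rewrite sum_n_head, duhamel_dp_sum by trivial.
  change (dp 0 t u) with (U t u). f_equal. apply sum_n_ext_loc. intros k Hk.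
  apply dp_duhamel; trivial. intros; apply H; lia.
Qed.

Lemma dp_good_0 : dp_good 0.
Proof.
  assert (HUt : tame U) by now apply semigroup_tame.
  split; trivial.
  - intros t s u Ht Hs. rewrite sum_O. now apply (sg_add U HU).
  - intros t u Ht. revert u. apply dom_linear_pos.
    + apply clinear_sub; [now apply sg_lin|].
      apply (clinear_sum_n (fun k => dp k t)). intros k Hk.
      replace k with 0%nat by lia. now apply sg_lin.
    + intros u Hu Pu. unfold dp_sum. rewrite sum_O, V_duhamel by trivial.
      change (dp 0 t u) with (U t u).
      vreplace (minus (plus (U t u) (duhamel V t u)) (U t u)) with (duhamel V t u).
      apply duhamel_pos; trivial. apply V_tame.
Qed.

(* The right-hand side tends to 0 as [t] does. *)
Lemma dp_small n t u :
  (forall k u, (k <= S n)%nat -> pos u -> pos (dp k t u)) ->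
  (forall u, pos u -> pos (minus (V t u) (dp_sum (S n) t u))) ->
  pos u -> norm (dp (S n) t u) <= norm (minus (V t u) (U t u)).
Proof.
  intros Hp Hd Hu. apply (pos_norm_mono HX); [now apply Hp|].
  vreplace (minus (minus (V t u) (U t u)) (dp (S n) t u)) with
    (minus (V t u) (plus (dp 0 t u) (dp (S n) t u))).
  (* The terms of index 0 and [S n] are distinct summands of the partial sum, so their sum lies
     below V(t) u. *)
  apply (pos_minus_trans HX _ (dp_sum (S n) t u)); [|now apply Hd].
  unfold dp_sum. rewrite sum_n_head.
  vreplace (minus (plus (dp 0 t u) (sum_n (fun k => dp (S k) t u) n))
      (plus (dp 0 t u) (dp (S n) t u))) with
    (minus (sum_n (fun k => dp (S k) t u) n) (dp (S n) t u)).
  apply (pos_sum_minus_term HX (fun k => dp (S k) t u)); [|lia].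
  intros k Hkn. apply Hp; trivial. lia.
Qed.

Lemma semigroup_lim_0 T u : is_substochastic_C0_semigroup X pos T ->
  filterlim (fun h => T h u) (at_right 0) (locally u).
Proof. intros H. apply (sg_continuous _ _ (sub_semigroup _ _ _ H)). Qed.

(** * The inductive step for the terms *)

Section Step.
Variable n : nat.
Hypothesis Hn : forall k, (k <= n)%nat -> dp_good k.

Lemma dp_step_linear t : 0 <= t -> is_linear (dp (S n) t).
Proof. intros Ht. apply (dp_extension n t Hn Ht). Qed.

Lemma dp_step_pos t u : 0 <= t -> pos u -> pos (dp (S n) t u).
Proof.
  intros Ht. revert u. apply dom_linear_pos; [now apply dp_step_linear|].
  intros u Hu Pu. rewrite dp_duhamel by trivial. apply duhamel_pos; trivial.
  now apply dp_tame, Hn.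
Qed.

Lemma dp_step_linear_le k t : (k <= S n)%nat -> 0 <= t -> is_linear (dp k t).
Proof.
  intros Hk Ht. destruct (Nat.eq_dec k (S n)) as [->|N]; [now apply dp_step_linear|].
  apply (tame_linear _ (dp_tame k (Hn k ltac:(lia)))); trivial.
Qed.

Lemma dp_step_pos_le k t u : (k <= S n)%nat -> 0 <= t -> pos u -> pos (dp k t u).
Proof.
  intros Hk Ht Hu. destruct (Nat.eq_dec k (S n)) as [->|N]; [now apply dp_step_pos|].
  apply (tame_pos _ (dp_tame k (Hn k ltac:(lia)))); trivial.
Qed.

(** On [D] both sides are U plus a Duhamel integral, and the induction hypothesis compares the
    integrands. *)
Lemma dp_step_dominated t u : 0 <= t -> pos u -> pos (minus (V t u) (dp_sum (S n) t u)).
Proof.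
  intros Ht. revert u. apply dom_linear_pos.
  - apply clinear_sub; [now apply sg_lin|].
    apply (clinear_sum_n (fun k => dp k t)). intros k Hk. now apply dp_step_linear_le.
  - intros u Hu Pu. rewrite V_duhamel, dp_sum_duhamel by trivial.
    vreplace (minus (plus (U t u) (duhamel V t u)) (plus (U t u) (duhamel (dp_sum n) t u)))
      with (minus (duhamel V t u) (duhamel (dp_sum n) t u)).
    apply duhamel_mono; trivial; [now apply dp_sum_tame|apply V_tame|].
    intros s v Hs Hv. apply (dp_dominated n (Hn n (le_n n))); trivial.
Qed.

Lemma dp_step_contr t u : 0 <= t -> pos u -> norm (dp (S n) t u) <= norm u.
Proof.
  intros Ht Hu. apply Rle_trans with (norm (V t u)); [|now apply HV].
  apply (pos_norm_mono HX); [now apply dp_step_pos|].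
  apply (pos_minus_trans HX _ (dp_sum (S n) t u)); [|now apply dp_step_dominated].
  apply (pos_sum_minus_term HX (fun k => dp k t u)); [|lia].
  intros k Hk. now apply dp_step_pos_le.
Qed.

(** For u in [D] the integral over [0, t + s] is cut at s. On [0, s] the formula at index n, with
    times t and s - r, yields the summands j <= n. On [s, t + s] the identity U(r) u = U(r-s) U(s) u
    and a shift yield the last summand. *)
Lemma dp_step_add t s u : 0 <= t -> 0 <= s ->
  dp (S n) (t + s) u = sum_n (fun j => dp j t (dp (S n - j) s u)) (S n).
Proof.
  intros Ht Hs. revert u. apply dom_linear_eq.
  - apply dp_step_linear. lra.
  - apply (clinear_sum_n (fun j u => dp j t (dp (S n - j) s u))). intros k Hk.
    apply (is_linear_comp (dp (S n - k) s) (dp k t)); apply dp_step_linear_le; trivial; lia.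
  - intros u Hu. assert (Tn := dp_tame n (Hn n (le_n n))).
    rewrite dp_duhamel by (trivial; lra).
    set (f r := dp n (Rmax 0 (t + s - r)) (B (U (Rmax 0 r) u))).
    rewrite sum_Sn, Nat.sub_diag. change (dp 0 s u) with (U s u).
    destruct (dom_orbit u s Hs Hu) as [Dw _].
    rewrite (dp_duhamel n t (U s u)) by trivial.
    rewrite (sum_n_ext_loc _ (fun j => dp j t (duhamel (dp (n - j)) s u))).
    2:{ intros j Hj. rewrite Nat.sub_succ_l by trivial. f_equal.
        apply dp_duhamel; trivial. intros k Hk; apply Hn; lia. }
    apply is_RInt_unique, (is_RInt_Chasles (V := X) f 0 s (t + s)).
    + apply is_RInt_ext with (fun r => sum_n (fun j => dp j t
        (dp (n - j) (Rmax 0 (s - r)) (B (U (Rmax 0 r) u)))) n).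
      * rewrite Rmin_left, Rmax_right by trivial. intros r Hr. unfold f.
        rewrite (Rmax_right 0 (s - r)), (Rmax_right 0 (t + s - r)) by lra.
        replace (t + s - r) with (t + (s - r)) by ring.
        symmetry. apply (dp_add n (Hn n (le_n n))); lra.
      * apply (is_RInt_sum_n (fun j r => dp j t
          (dp (n - j) (Rmax 0 (s - r)) (B (U (Rmax 0 r) u))))).
        intros k Hk. apply (is_RInt_linear (dp k t)); [now apply (dp_tame k (Hn k Hk))|].
        apply duhamel_correct; trivial. apply dp_tame, Hn. lia.
    + apply is_RInt_ext with
        (fun r => (fun q => dp n (Rmax 0 (t - q)) (B (U (Rmax 0 q) (U s u)))) (r + - s)).
      * rewrite Rmin_left, Rmax_right by lra. intros r Hr. unfold f.
        rewrite (Rmax_right 0 r), (Rmax_right 0 (r + - s)) by lra.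
        rewrite <- (sg_add U HU) by lra. now replace (t - (r + - s)) with (t + s - r) by ring;
        replace (r + - s + s) with r by ring.
      * apply (is_RInt_shift (fun q => dp n (Rmax 0 (t - q)) (B (U (Rmax 0 q) (U s u))))).
        rewrite Rplus_opp_r. replace (t + s + - s) with t by ring.
        now apply duhamel_correct.
Qed.

Lemma dp_step_norm_le k t u : (k <= S n)%nat -> 0 <= t -> norm (dp k t u) <= M * norm u.
Proof.
  intros Hk Ht. apply cone_contraction_bound; [now apply dp_step_linear_le|].
  intros v Hv. destruct (Nat.eq_dec k (S n)) as [->|N]; [now apply dp_step_contr|].
  apply (tame_contr _ (dp_tame k (Hn k ltac:(lia)))); trivial.
Qed.

Lemma dp_step_small k u : (k <= n)%nat ->
  filterlim (fun h => norm (dp (S k) h u)) (at_right 0) (locally 0).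
Proof.
  intros Hk. destruct (Hdec u) as [v [w [Hv [Hw [-> _]]]]].
  assert (L : forall x, filterlim (fun h => minus (V h x) (U h x)) (at_right 0) (locally (@zero X))).
  { intros x. replace (@zero X) with (minus x x) by vec.
    apply lim_minus; now apply semigroup_lim_0. }
  assert (B1 : forall h x, 0 < h -> pos x ->
    norm (dp (S k) h x) <= norm (minus (V h x) (U h x))).
  { intros h x Hh Hx. apply dp_small; trivial.
    - intros j y Hj Hy. apply dp_step_pos_le; trivial; [lia|lra].
    - intros y Hy. destruct (Nat.eq_dec k n) as [->|N]; [apply dp_step_dominated; trivial; lra|].
      apply (dp_dominated (S k) (Hn (S k) ltac:(lia))); trivial; lra. }
  assert (K : filterlim (fun h => dp (S k) h (minus v w)) (at_right 0) (locally (@zero X))).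
  { apply lim_zero_le with (g := fun h => norm (minus (minus (V h v) (U h v)) zero) +
      norm (minus (minus (V h w) (U h w)) zero)).
    - generalize at_right_0_pos. apply filter_imp. intros h Hh.
      rewrite (clinear_minus (dp (S k) h)) by (apply dp_step_linear_le; [lia|lra]).
      vreplace (minus (minus (dp (S k) h v) (dp (S k) h w)) zero) with
        (minus (dp (S k) h v) (dp (S k) h w)).
      vreplace (minus (minus (V h v) (U h v)) zero) with (minus (V h v) (U h v)).
      vreplace (minus (minus (V h w) (U h w)) zero) with (minus (V h w) (U h w)).
      apply Rle_trans with (1 := norm_minus_le _ _).
      apply Rplus_le_compat; now apply B1.
    - apply limR_zero_plus; apply lim_norm_zero, L. }
  apply filterlim_ext with (2 := lim_norm_zero _ _ K). intros h. f_equal. vec.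
Qed.

(** The addition formula for the times r and h puts the small time next to u. In the increment,
    every summand j <= n contains a term of positive index at time h, small by [dp_step_small]; the
    last one contains U(h) u - u. The bound is uniform in r. *)
Lemma dp_step_cont u t : continuous (fun s => dp (S n) (Rmax 0 s) u) t.
Proof.
  apply (continuous_from_modulus (fun s => dp (S n) s u) (fun h =>
    M * sum_f_R0 (fun j => norm (dp (S (n - j)) h u)) n + M * norm (minus (U h u) u))).
  - intros r h Hr Hh. rewrite dp_step_add by lra.
    rewrite sum_Sn, Nat.sub_diag. change (dp 0 h u) with (U h u).
    vreplace (minus (plus (sum_n (fun j => dp j r (dp (S n - j) h u)) n)
        (dp (S n) r (U h u))) (dp (S n) r u)) with
      (plus (sum_n (fun j => dp j r (dp (S n - j) h u)) n)
        (minus (dp (S n) r (U h u)) (dp (S n) r u))).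
    rewrite <- clinear_minus by now apply dp_step_linear_le.
    apply Rle_trans with (1 := cnorm_triangle _ _).
    apply Rplus_le_compat; [|now apply dp_step_norm_le].
    assert (G : forall m, (m <= n)%nat ->
      norm (sum_n (fun j => dp j r (dp (S n - j) h u)) m) <=
      M * sum_f_R0 (fun j => norm (dp (S (n - j)) h u)) m).
    { induction m as [|m IH]; intros Hm.
      - rewrite sum_O. cbn [sum_f_R0]. rewrite !Nat.sub_0_r. apply dp_step_norm_le; [lia|trivial].
      - rewrite sum_Sn. apply Rle_trans with (1 := cnorm_triangle _ _).
        cbn [sum_f_R0]. rewrite Rmult_plus_distr_l.
        apply Rplus_le_compat; [apply IH; lia|].
        replace (S n - S m)%nat with (S (n - S m)) by lia.
        apply dp_step_norm_le; [lia|trivial]. }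
    now apply G.
  - apply limR_zero_plus; apply limR_zero_scal.
    + assert (G : forall m, (m <= n)%nat -> filterlim
        (fun h => sum_f_R0 (fun j => norm (dp (S (n - j)) h u)) m) (at_right 0) (locally 0)).
      { induction m as [|m IH]; intros Hm; cbn [sum_f_R0].
        - apply dp_step_small. lia.
        - apply limR_zero_plus; [apply IH; lia|]. apply dp_step_small. lia. }
      now apply G.
    + now apply lim_norm_zero, semigroup_lim_0.
Qed.

Lemma dp_good_step : dp_good (S n).
Proof.
  split.
  - split.
    + apply dp_step_linear.
    + apply dp_step_pos.
    + apply dp_step_contr.
    + apply dp_step_cont.
  - intros. now apply dp_step_add.
  - apply dp_step_dominated.
Qed.
End Step.

Lemma dp_good_all n : dp_good n.
Proof.
  enough (H : forall n k, (k <= n)%nat -> dp_good k) by now apply (H n).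
  clear n. induction n as [|n IH]; intros k Hk.
  - replace k with 0%nat by lia. apply dp_good_0.
  - destruct (Nat.eq_dec k (S n)) as [->|N]; [now apply dp_good_step|apply IH; lia].
Qed.

(** * The sum of the Dyson-Phillips series *)

Definition dp_series (t : R) (u : X) : X :=
  epsilon (inhabits (@zero X))
    (fun l : X => filterlim (fun n => dp_sum n t u) eventually (locally l)).

Lemma dp_pos n t u : 0 <= t -> pos u -> pos (dp n t u).
Proof. apply (tame_pos _ (dp_tame n (dp_good_all n))). Qed.

Lemma dp_sum_is_tame n : tame (dp_sum n).
Proof. apply dp_sum_tame. intros; apply dp_good_all. Qed.

Lemma dp_sum_le_V n t u : 0 <= t -> pos u -> pos (minus (V t u) (dp_sum n t u)).
Proof. apply (dp_dominated n (dp_good_all n)). Qed.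

Lemma dp_series_lim t u : 0 <= t ->
  filterlim (fun n => dp_sum n t u) eventually (locally (dp_series t u)).
Proof.
  intros Ht. unfold dp_series. apply epsilon_spec.
  assert (K : forall u, pos u ->
    exists l : X, filterlim (fun n => dp_sum n t u) eventually (locally l)).
  { intros v Hv. apply (pos_series HX (fun k => dp k t v) (norm v)).
    - intros n. now apply dp_pos.
    - intros n. now apply (tame_contr _ (dp_sum_is_tame n)). }
  destruct (Hdec u) as [v [w [Hv [Hw [-> _]]]]].
  destruct (K v Hv) as [l Hl], (K w Hw) as [k Hk].
  exists (minus l k). apply filterlim_ext with (2 := lim_minus _ _ _ _ Hl Hk).
  intros n. symmetry. now apply clinear_minus, (tame_linear _ (dp_sum_is_tame n)).
Qed.

Lemma dp_series_le_V t u : 0 <= t -> pos u -> pos (minus (V t u) (dp_series t u)).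
Proof.
  intros Ht Hu.
  apply (pos_lim HX (F := eventually) (fun n => minus (V t u) (dp_sum n t u))).
  - apply lim_minus; [apply filterlim_const|now apply dp_series_lim].
  - apply filter_forall. intros n. now apply dp_sum_le_V.
Qed.

Lemma dp_sum_le_series n t u : 0 <= t -> pos u ->
  pos (minus (dp_series t u) (dp_sum n t u)).
Proof.
  intros Ht Hu.
  apply (pos_lim HX (F := eventually) (fun m => minus (dp_sum m t u) (dp_sum n t u))).
  - apply lim_minus; [now apply dp_series_lim|apply filterlim_const].
  - exists n. intros m Hm. apply (pos_sum_mono HX (fun k => dp k t u)); trivial.
    intros k. now apply dp_pos.
Qed.

Lemma dp_series_pos t u : 0 <= t -> pos u -> pos (dp_series t u).
Proof.
  intros Ht Hu. apply (pos_le_trans HX (dp_sum 0 t u)).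
  - now apply (tame_pos _ (dp_sum_is_tame 0)).
  - now apply dp_sum_le_series.
Qed.

Lemma dp_series_linear t : 0 <= t -> is_linear (dp_series t).
Proof.
  intros Ht. assert (L := fun n => tame_linear _ (dp_sum_is_tame n) t Ht). split.
  - intros u v. apply (lim_unique (F := eventually) (fun n => dp_sum n t (plus u v)));
      [now apply dp_series_lim|].
    apply filterlim_ext with (2 := lim_plus _ _ _ _ (dp_series_lim t u Ht) (dp_series_lim t v Ht)).
    intros n. symmetry. apply (linear_plus _ (L n)).
  - intros c u. apply (lim_unique (F := eventually) (fun n => dp_sum n t (scal c u)));
      [now apply dp_series_lim|].
    apply filterlim_ext with (2 := lim_scal c _ _ (dp_series_lim t u Ht)).
    intros n. symmetry. apply (linear_scal _ (L n)).
  - exists M. split; trivial. intros u.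
    apply (lim_norm_le (F := eventually) _ _ _ (dp_series_lim t u Ht)).
    apply filter_forall. intros n. apply tame_bound; trivial. apply dp_sum_is_tame.
Qed.

(** On the cone, the partial sums at time t + s run over triangles ([E1]) and the products of
    partial sums over squares ([E2]). The inclusions between these index sets give both inequalities
    in the limit. *)
Lemma dp_series_add t s u : 0 <= t -> 0 <= s ->
  dp_series (t + s) u = dp_series t (dp_series s u).
Proof.
  intros Ht Hs. revert u. apply linear_cone_eq.
  - apply dp_series_linear. lra.
  - apply (is_linear_comp (dp_series s) (dp_series t)); now apply dp_series_linear.
  - intros u Hu.
    assert (K : filterlim (fun n => dp_sum n t (dp_sum n s u)) eventually
      (locally (dp_series t (dp_series s u)))).
    { apply (lim_equicontinuous (fun n => dp_sum n t) _ (dp_series s u) _ M).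
      - apply filter_forall. intros n v w. symmetry.
        now apply clinear_minus, (tame_linear _ (dp_sum_is_tame n)).
      - apply filter_forall. intros n v. apply tame_bound; trivial. apply dp_sum_is_tame.
      - now apply dp_series_lim.
      - now apply dp_series_lim. }
    set (a j k := dp j t (dp k s u)).
    assert (Ha : forall j k, pos (a j k)) by (intros; now apply dp_pos, dp_pos).
    assert (E1 : forall n, dp_sum n (t + s) u =
      sum_n (fun k => sum_n (fun j => a j (k - j)%nat) k) n).
    { intros n. apply sum_n_ext. intros k. now apply (dp_add k (dp_good_all k)). }
    assert (E2 : forall n, dp_sum n t (dp_sum n s u) = sum_n (fun j => sum_n (a j) n) n).
    { intros n. apply sum_n_ext. intros j. unfold dp_sum, a.
      now apply clinear_of_sum_n, (tame_linear _ (dp_tame j (dp_good_all j))). }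
    apply (pos_minus_antisym HX).
    + apply (pos_lim HX (F := eventually)
        (fun n => minus (dp_series (t + s) u) (dp_sum n t (dp_sum n s u)))).
      * apply lim_minus; [apply filterlim_const|trivial].
      * apply filter_forall. intros n.
        apply (pos_minus_trans HX _ (dp_sum (n + n) (t + s) u));
          [|apply dp_sum_le_series; trivial; lra].
        rewrite E1, E2. now apply (pos_square_triangle HX).
    + apply (pos_lim HX (F := eventually)
        (fun n => minus (dp_sum n t (dp_sum n s u)) (dp_sum n (t + s) u))).
      * apply lim_minus; trivial. apply dp_series_lim. lra.
      * apply filter_forall. intros n.
        rewrite E1, E2. now apply (pos_triangle_square HX).
Qed.

Lemma U_le_dp_series t u : 0 <= t -> pos u -> pos (minus (dp_series t u) (U t u)).
Proof.
  intros Ht Hu. generalize (dp_sum_le_series 0 t u Ht Hu). unfold dp_sum. now rewrite sum_O.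
Qed.

(** The value at time 0 and continuity there are forced on the cone by squeezing the sum between U
    and V; contractivity is inherited from V. *)
Lemma dp_series_substochastic : is_substochastic_C0_semigroup X pos dp_series.
Proof.
  split; [split| |].
  - apply dp_series_linear.
  - intros u. apply (linear_cone_eq (dp_series 0) (fun u => u)).
    + apply dp_series_linear. lra.
    + apply is_linear_id.
    + intros v Hv. apply (pos_minus_antisym HX).
      * generalize (U_le_dp_series 0 v ltac:(lra) Hv). now rewrite (sg_id U HU).
      * generalize (dp_series_le_V 0 v ltac:(lra) Hv). now rewrite (sg_id V HV).
  - intros s t u Hs Ht. now apply dp_series_add.
  - assert (K : forall u, pos u ->
      filterlim (fun t => dp_series t u) (at_right 0) (locally u)).
    { intros u Hu. apply lim_zero_le with (g := fun h =>
        norm (minus (V h u) u) + (norm (minus (U h u) u) + norm (minus (U h u) u))).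
      - generalize at_right_0_pos. apply filter_imp. intros h Hh.
        assert (Q : norm (minus (dp_series h u) (U h u)) <= norm (minus (V h u) (U h u))).
        { apply (pos_norm_mono HX); [apply U_le_dp_series; trivial; lra|].
          vreplace (minus (minus (V h u) (U h u)) (minus (dp_series h u) (U h u))) with
            (minus (V h u) (dp_series h u)).
          apply dp_series_le_V; trivial; lra. }
        generalize (norm_minus_trans (dp_series h u) (U h u) u)
          (norm_minus_trans (V h u) u (U h u)).
        rewrite (norm_minus_sym u). lra.
      - repeat apply limR_zero_plus; now apply lim_norm_zero, semigroup_lim_0. }
    intros u. destruct (Hdec u) as [v [w [Hv [Hw [-> _]]]]].
    apply filterlim_ext_loc with (2 := lim_minus _ _ _ _ (K v Hv) (K w Hw)).
    generalize at_right_0_pos. apply filter_imp. intros h Hh. symmetry.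
    apply clinear_minus, dp_series_linear. lra.
  - intros t u. apply dp_series_pos.
  - intros t u Ht Hu. apply Rle_trans with (norm (V t u)); [|now apply HV].
    apply (pos_norm_mono HX); [now apply dp_series_pos|now apply dp_series_le_V].
Qed.

(** The quotient is the mean over [0, h] of U(h-s) B U(s) u, and this integrand is close to [B u]
    uniformly in s when h is small. *)
Lemma dp_1_rate u : D u -> filterlim (fun h => scal (/ h) (dp 1 h u)) (at_right 0) (locally (B u)).
Proof.
  intros Hu. apply (proj2 (lim_norm_iff _ (B u))). intros eps He.
  (* The operator U(h-s) may enlarge the error of B U(s) u by a factor [M]; together with the error
     of U(h-s) B u the total stays below eps / 2. *)
  assert (H2M : 0 < eps / (4 * M)) by (apply Rdiv_lt_0_compat; lra).
  destruct (proj1 (continuous_iff _ _) (B_orbit_cont u 0 Hu) _ H2M) as [d1 [Hd1 K1]].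
  destruct (proj1 (continuous_iff _ _) (orbit_cont U HU (B u) 0) (eps / 4) ltac:(lra))
    as [d2 [Hd2 K2]].
  rewrite Rmax_left, (sg_id U HU) in K1 by lra.
  rewrite Rmax_left, (sg_id U HU) in K2 by lra.
  apply at_right_0_iff. exists (Rmin d1 d2). split; [now apply Rmin_glb_lt|].
  intros h [Hh Hd].
  assert (h < d1 /\ h < d2) as [L1 L2].
  { generalize (Rmin_l d1 d2) (Rmin_r d1 d2). lra. }
  rewrite dp_duhamel by (trivial; try lra; intros; apply dp_good_all).
  change (dp 0) with U.
  assert (HUt : tame U) by now apply semigroup_tame.
  assert (Q : norm (minus (duhamel U h u) (scal (h - 0) (B u))) <= (h - 0) * (eps / 2)).
  { apply norm_RInt_le_const with (f := fun s =>
      minus (U (Rmax 0 (h - s)) (B (U (Rmax 0 s) u))) (B u)); [lra| |].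
    - intros s Hs.
      apply Rle_trans with (1 := norm_minus_trans _ (U (Rmax 0 (h - s)) (B u)) _).
      rewrite <- clinear_minus by apply (sg_lin U HU), Rmax_l.
      assert (norm (minus (U (Rmax 0 (h - s)) (B u)) (B u)) < eps / 4).
      { apply K2. rewrite Rminus_0_r, Rabs_pos_eq; lra. }
      assert (norm (minus (B (U (Rmax 0 s) u)) (B u)) < eps / (4 * M)).
      { apply K1. rewrite Rminus_0_r, Rabs_pos_eq; lra. }
      assert (norm (U (Rmax 0 (h - s)) (minus (B (U (Rmax 0 s) u)) (B u))) <=
        M * (eps / (4 * M))).
      { apply Rle_trans with (1 := sg_norm U HU _ _ (Rmax_l _ _)).
        apply Rmult_le_compat_l; lra. }
      replace (M * (eps / (4 * M))) with (eps / 4) in * by (field; lra). lra.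
    - apply is_RInt_minus'; [now apply duhamel_correct|].
      exact (@is_RInt_const X 0 h (B u)). }
  vreplace (minus (scal (/ h) (duhamel U h u)) (B u)) with
    (scal (/ h) (minus (duhamel U h u) (scal (h - 0) (B u)))).
  assert (0 < / h) by now apply Rinv_0_lt_compat.
  apply Rle_lt_trans with (1 := norm_scal_le _ _). rewrite Rabs_pos_eq by lra.
  apply Rle_lt_trans with (/ h * ((h - 0) * (eps / 2))).
  - apply Rmult_le_compat_l; lra.
  - replace (/ h * ((h - 0) * (eps / 2))) with (eps / 2) by (field; lra). lra.
Qed.

(* On [D] and the cone, [U + L(U) <= dp_series <= V], and the two extremes have the
   same right derivative at 0. *)
Lemma dp_series_generator : generator_extends X dp_series D (fun u => plus (A u) (B u)).
Proof.
  assert (K : forall u, D u -> pos u -> generator_graph X dp_series u (plus (A u) (B u))).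
  { intros u Hu Pu.
    assert (LV := HVG u Hu). assert (LU := proj2 HA u Hu). assert (L1 := dp_1_rate u Hu).
    unfold generator_graph in *. cbv beta in LV.
    assert (L0 : filterlim (fun h => scal (/ h) (minus (V h u) (dp_series h u)))
      (at_right 0) (locally (@zero X))).
    { assert (LD := lim_minus _ _ _ _ (lim_minus _ _ _ _ LV LU) L1). cbv beta in LD.
      replace (minus (minus (plus (A u) (B u)) (A u)) (B u)) with (@zero X) in LD by vec.
      apply lim_zero_le with (2 := lim_norm_zero _ _ LD).
      generalize at_right_0_pos. apply filter_imp. intros h Hh.
      vreplace (minus (scal (/ h) (minus (V h u) (dp_series h u))) zero) with
        (scal (/ h) (minus (V h u) (dp_series h u))).
      vreplace (minus (minus (minus (scal (/ h) (minus (V h u) u))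
        (scal (/ h) (minus (U h u) u))) (scal (/ h) (dp 1 h u))) zero) with
        (scal (/ h) (minus (V h u) (plus (U h u) (dp 1 h u)))).
      assert (0 < / h) by now apply Rinv_0_lt_compat.
      apply (pos_norm_mono HX).
      - apply (pos_scal _ _ HX); [lra|]. apply dp_series_le_V; trivial; lra.
      - vreplace (minus (scal (/ h) (minus (V h u) (plus (U h u) (dp 1 h u))))
          (scal (/ h) (minus (V h u) (dp_series h u)))) with
          (scal (/ h) (minus (dp_series h u) (plus (U h u) (dp 1 h u)))).
        apply (pos_scal _ _ HX); [lra|].
        generalize (dp_sum_le_series 1 h u ltac:(lra) Pu).
        unfold dp_sum. now rewrite sum_Sn, sum_O. }
    assert (LD := lim_minus _ _ _ _ LV L0). cbv beta in LD.
    replace (plus (A u) (B u)) with (minus (plus (A u) (B u)) zero) by vec.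
    apply filterlim_ext with (2 := LD). intros h. vec. }
  (* The squeeze works for positive elements of [D]; a general element of [D] is a difference of two
     of them. *)
  intros u Hu. destruct (dom_generating u Hu) as [v [w [Hv [Hw [Pv [Pw ->]]]]]].
  rewrite dom_A_minus, B_minus by trivial.
  vreplace (minus v w) with (plus v (scal (-1) w)).
  vreplace (plus (minus (A v) (A w)) (minus (B v) (B w))) with
    (plus (plus (A v) (B v)) (scal (-1) (plus (A w) (B w)))).
  apply (generator_graph_plus dp_series dp_series_substochastic); [now apply K|].
  apply (generator_graph_scal dp_series dp_series_substochastic). now apply K.
Qed.

Hypothesis HVmin : forall W : R -> X -> X,
  is_substochastic_C0_semigroup X pos W ->
  generator_extends X W D (fun u => plus (A u) (B u)) ->
  forall (t : R) (u : X), 0 <= t -> pos u -> pos (minus (W t u) (V t u)).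

Lemma V_dp_series t u : 0 <= t -> V t u = dp_series t u.
Proof.
  intros Ht. revert u. apply linear_cone_eq.
  - now apply sg_lin.
  - now apply dp_series_linear.
  - intros u Hu. apply (pos_minus_antisym HX); [now apply dp_series_le_V|].
    apply HVmin; trivial; [apply dp_series_substochastic|apply dp_series_generator].
Qed.

End Perturbation.
End StateSpace.

Theorem theorem2p3 (X : CompleteNormedModule R_AbsRing) (pos : X -> Prop)
  (HX : is_abstract_state_space X pos)
  (Psi : X -> R) (HPsi : is_norm_functional X pos Psi)
  (U : R -> X -> X) (HU : is_substochastic_C0_semigroup X pos U)
  (D : X -> Prop) (A : X -> X) (HA : is_generator X U D A)
  (B : X -> X) (HB : is_positive_linear_on X pos D B)
  (HAB : forall u : X, D u -> pos u -> Psi (plus (A u) (B u)) <= 0)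
  (V : R -> X -> X)
  (HV : is_minimal_semigroup X pos D (fun u : X => plus (A u) (B u)) V) :
  (forall (t : R) (u : X), 0 <= t -> D u ->
     ex_RInt (fun s : R => V (t - s) (B (U s u))) 0 t /\
     V t u = plus (U t u) (RInt (fun s : R => V (t - s) (B (U s u))) 0 t)) /\
  (forall (t : R) (u : X), 0 <= t ->
     is_series (fun n : nat => DP_term X D B U n t u) (V t u)).
Proof.
  destruct (bounded_decomposition HX) as [M [HM Hdec]].
  destruct HV as [HVs HVG HVmin].
  split.
  - intros t u Ht Hu.
    assert (TV := semigroup_tame Hdec V HVs).
    assert (K := proj2 (duhamel_is_RInt HX Hdec U HU D A HA Psi HPsi B HB HAB V t u
      (duhamel U B V t u) Ht TV Hu) eq_refl).
    split; [now eexists; apply K|].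
    rewrite (is_RInt_unique _ _ _ _ K).
    now apply (V_duhamel HX Hdec U HU D A HA Psi HPsi B HB HAB V HVs HVG).
  - intros t u Ht.
    rewrite (V_dp_series HX HM Hdec U HU D A HA Psi HPsi B HB HAB V HVs HVG HVmin t u Ht).
    (* [is_series] unfolds to the convergence of the partial sums [dp_sum]. *)
    now apply (dp_series_lim HX HM Hdec U HU D A HA Psi HPsi B HB HAB V HVs HVG).
Qed.
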